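(* Let $(M,g,S(TM),S(TM^\perp))$ be an irrotational half-lightlike submanifold of an $(m+2)$-dimensional Lorentzian manifold $(\overline M(k),\overline g)$ of constant curvature $k$. Assume that $E_0=\xi,E_1,\dots,E_{m-1}$ are eigenvector fields of $\stackrel{\ast}{A}_\xi$ satisfying $\stackrel{\ast}{A}_\xi E_0=0$ and $\stackrel{\ast}{A}_\xi E_i=\lambda_iE_i$ ($1\le i\le m-1$), where $\{E_i\}_{i=1,\dots,m-1}$ is an orthonormal basis of $S(TM)$, such that $\lambda_i$ is constant along $S(TM)$ for all $i$, and that $\tau=0$. Then for every $i\in\{1,\dots,m-1\}$, $$\sum_{\substack{j=1\\ \lambda_j\ne\lambda_i}}^{m-1}\frac{k+\lambda_j\,g(A_NE_i,E_i)+\lambda_i\,g(A_NE_j,E_j)+g(A_LE_j,E_j)\,g(A_LE_i,E_i)-g(A_LE_i,E_j)^2}{\lambda_i-\lambda_j}=0 .$$ Moreover, if $M$ is screen conformal with conformal factor $\varphi$, then for every $i\in\{1,\dots,m-1\}$, $$\sum_{\substack{j=1\\ \lambda_j\ne\lambda_i}}^{m-1}\frac{k+2\varphi\lambda_i\lambda_j+g(A_LE_j,E_j)\,g(A_LE_i,E_i)-g(A_LE_i,E_j)^2}{\lambda_i-\lambda_j}=0 .$$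
   Context: Let $M$ be an $m$-dimensional submanifold of an $(m+2)$-dimensional semi-Riemannian manifold $(\overline M,\overline g)$ of index $\ge 1$ (Lorentzian: index $1$), with Levi-Civita connection $\overline\nabla$ and (degenerate) induced metric $g$. $M$ is half-lightlike if $Rad(TM)=TM\cap TM^\perp$ has rank one. A screen distribution $S(TM)$ is a non-degenerate complement of $Rad(TM)$ in $TM$; a co-screen distribution $S(TM^\perp)$ is a non-degenerate complement (of rank one) of $Rad(TM)$ in $TM^\perp$. Fix $L\in\Gamma(S(TM^\perp))$ with $\overline g(L,L)=1$ and a local nowhere zero section $\xi$ of $Rad(TM)$; $N$ is the unique null section of the orthogonal complement of $S(TM)\oplus S(TM^\perp)$ in $T\overline M|_M$ with $\overline g(\xi,N)=1$, so $\overline g(N,N)=\overline g(N,X)=\overline g(N,L)=0$ for $X\in\Gamma(S(TM))$. $P:TM\to S(TM)$ is the projection along $Rad(TM)$. For $X,Y\in\Gamma(TM)$ the Gauss–Weingarten formulas $$\overline\nabla_XY=\nabla_XY+B(X,Y)N+D(X,Y)L,\quad \overline\nabla_XN=-A_NX+\tau(X)N+\rho(X)L,\quad \overline\nabla_XL=-A_LX+\phi(X)N,$$ $$\nabla_XPY=\stackrel{\ast}{\nabla}_XPY+C(X,PY)\xi,\qquad \nabla_X\xi=-\stackrel{\ast}{A}_\xi X-\tau(X)\xi$$ define the induced connections $\nabla$ on $TM$ and $\stackrel{\ast}{\nabla}$ on $S(TM)$, the local second fundamental forms $B,D,C$, the shape operators $A_N,A_L$ (with values in $TM$) and $\stackrel{\ast}{A}_\xi$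 (with values in $S(TM)$), and the $1$-forms $\tau,\rho,\phi$. $M$ is irrotational if $\overline\nabla_X\xi\in\Gamma(TM)$ for all $X\in\Gamma(TM)$, equivalently $D(X,\xi)=-\phi(X)=0$ for all $X\in\Gamma(TM)$. A function $\lambda$ is constant along $S(TM)$ if $W(\lambda)=0$ for all $W\in\Gamma(S(TM))$. $M$ is screen conformal with conformal factor $\varphi$ ($\varphi$ a non-zero smooth function) if $A_NX=\varphi\stackrel{\ast}{A}_\xi X$ for all $X\in\Gamma(TM)$. Constant curvature $k$ means $\overline R(X,Y)Z=k\{\overline g(Y,Z)X-\overline g(X,Z)Y\}$. *)

(* Defs.v *)
From HB Require Import structures.
From mathcomp Require Import all_boot all_order all_algebra.
From mathcomp Require Import all_classical all_reals all_analysis.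
Set Implicit Arguments.
Unset Strict Implicit.
Unset Printing Implicit Defensive.
Import Order.TTheory GRing.Theory Num.Theory.
Import numFieldNormedType.Exports.
Local Open Scope classical_set_scope.
Local Open Scope ring_scope.

Section Smooth_maps.
Context {R : realType} {V W : normedModType R}.

Definition iter_derive (F : V -> W) (vs : seq V) : V -> W :=
  foldr (fun v G => 'D_v G) F vs.

(* [F] is of class C^oo on the open set [O]. *)
Definition smooth_on (O : set V) (F : V -> W) : Prop :=
  forall (vs : seq V) (x : V), O x -> differentiable (iter_derive F vs) x.

End Smooth_maps.

(* A manifold comes with a preferred chart [chart_at p] around each point [p],
   and the tangent space at [p] is R^n, a row vector being read as the list of
   components in the preferred chart at [p].  Vector fields, metrics, etc. are
   thus plain functions of [p], and their regularity is tested on their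
   components in the charts of the atlas. *)
Record manifold (R : realType) (n : nat) := Manifold {
  carrier :> topologicalType;
  chart : Type;
  dom : chart -> set carrier;
  coord : chart -> carrier -> 'rV[R]_n;
  param : chart -> 'rV[R]_n -> carrier;
  chart_at : carrier -> chart;
  hausdorff : hausdorff_space carrier;
  countable_basis : @second_countable carrier;
  dom_open : forall a, open (dom a);
  image_open : forall a, open (coord a @` dom a);
  coordK : forall a p, dom a p -> param a (coord a p) = p;
  coord_continuous : forall a, {within dom a, continuous (coord a)};
  param_continuous : forall a, {within coord a @` dom a, continuous (param a)};
  mem_chart_at : forall p, dom (chart_at p) p;
  transition_smooth : forall a b,
    smooth_on (coord a @` (dom a `&` dom b)) (coord b \o param a) }.

Section Calculus.
Context {R : realType}.

(* Row [k] is the coordinate vector d/dx^k of the chart [a], as an element of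
   the tangent space at [x]. *)
Definition chart_frame n (M : manifold R n) (a : chart M) (x : M) : 'M[R]_n :=
  jacobian (coord (chart_at x) \o param a) (coord a x).

(* Matrix of the change of basis from the tangent space at [x] to the
   components in the chart [a]: the inverse of [chart_frame a x]. *)
Definition chart_comp n (M : manifold R n) (a : chart M) (x : M) : 'M[R]_n :=
  jacobian (coord a \o param (chart_at x)) (coord (chart_at x) x).

(* The derivative v(F) of a function along a tangent vector [v] at [p]. *)
Definition tderive n (M : manifold R n) (W : normedModType R)
    (p : M) (v : 'rV[R]_n) (F : M -> W) : W :=
  'D_v (F \o param (chart_at p)) (coord (chart_at p) p).

Definition smooth_fun n (M : manifold R n) (U : set M) (F : M -> R) : Prop :=
  forall i : chart M, smooth_on (coord i @` (dom i `&` U)) (F \o param i).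

Definition smooth_map n n' (M : manifold R n) (M' : manifold R n')
    (f : M -> M') : Prop :=
  continuous f /\
  forall (i : chart M) (a : chart M'),
    smooth_on (coord i @` (dom i `&` f @^-1` dom a))
              (coord a \o f \o param i).

Definition tangent_map n n' (M : manifold R n) (M' : manifold R n')
    (f : M -> M') (p : M) : 'M[R]_(n, n') :=
  jacobian (coord (chart_at (f p)) \o f \o param (chart_at p))
           (coord (chart_at p) p).

Definition push n n' (M : manifold R n) (M' : manifold R n')
    (f : M -> M') (X : M -> 'rV[R]_n) : M -> 'rV[R]_n' :=
  fun p => X p *m tangent_map f p.

Definition comp_along n n' (M : manifold R n) (M' : manifold R n')
    (f : M -> M') (V : M -> 'rV[R]_n') (a : chart M') : M -> 'rV[R]_n' :=
  fun p => V p *m chart_comp a (f p).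

(* Smooth sections over [U] of the pull-back of TM' by [f]. *)
Definition smooth_along n n' (M : manifold R n) (M' : manifold R n')
    (f : M -> M') (U : set M) (V : M -> 'rV[R]_n') : Prop :=
  forall (i : chart M) (a : chart M'),
    smooth_on (coord i @` (dom i `&` f @^-1` dom a `&` U))
              (comp_along f V a \o param i).

Definition smooth_field n (M : manifold R n) (U : set M)
    (X : M -> 'rV[R]_n) : Prop :=
  smooth_along (fun p : M => p) U X.

(* Distributions are given pointwise by the row space of a square matrix. *)
Definition smooth_distribution n n' (M : manifold R n) (M' : manifold R n')
    (f : M -> M') (r : nat) (S : M -> 'M[R]_n') : Prop :=
  forall p : M, exists (O : set M) (F : 'I_r -> M -> 'rV[R]_n'),
    [/\ open O, O p, forall k, smooth_along f O (F k) &
      forall q, O q -> (S q == \matrix_k F k q)%MS /\ \rank (S q) = r].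

Definition immersed_submanifold n n' (M : manifold R n) (M' : manifold R n')
    (f : M -> M') : Prop :=
  [/\ smooth_map f, injective f & forall p, row_free (tangent_map f p)].

End Calculus.

Section Semi_Riemannian.
Context {R : realType} {n : nat} {M : manifold R n} (G : M -> 'M[R]_n).

Definition gbar (x : M) (v w : 'rV[R]_n) : R := (v *m G x *m w^T) 0 0.

Definition chart_metric (a : chart M) (x : M) : 'M[R]_n :=
  chart_frame a x *m G x *m (chart_frame a x)^T.

Definition negative_definite (x : M) (W : 'M[R]_n) : Prop :=
  forall v : 'rV[R]_n, (v <= W)%MS -> v != 0 -> gbar x v v < 0.

Definition semi_riemannian (q : nat) : Prop :=
  [/\ forall x, (G x)^T = G x,
      forall x, G x \in unitmx,
      forall a : chart M,
        smooth_on (coord a @` dom a) (chart_metric a \o param a) &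
      forall x, (exists2 W : 'M[R]_n, \rank W = q & negative_definite x W) /\
                (forall W : 'M[R]_n, negative_definite x W -> (\rank W <= q)%N)].

Definition lorentzian : Prop := semi_riemannian 1.

Definition coord_derive (a : chart M) (b : 'I_n) (F : M -> R) (x : M) : R :=
  'D_(delta_mx 0 b) (F \o param a) (coord a x).

(* Gamma^c_{bd}, in the chart [a], of the Levi-Civita connection. *)
Definition christoffel (a : chart M) (c b d : 'I_n) (x : M) : R :=
  2^-1 * \sum_e invmx (chart_metric a x) c e *
    (coord_derive a b (fun y => chart_metric a y e d) x
     + coord_derive a d (fun y => chart_metric a y e b) x
     - coord_derive a e (fun y => chart_metric a y b d) x).

(* The component R^d_{c,ab}, where
   R(d_a, d_b) d_c = (nabla_a nabla_b - nabla_b nabla_a) d_c = R^d_{c,ab} d_d. *)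
Definition riemann_comp (h : chart M) (d c a b : 'I_n) (x : M) : R :=
  coord_derive h a (christoffel h d b c) x
  - coord_derive h b (christoffel h d a c) x
  + \sum_e (christoffel h d a e x * christoffel h e b c x
            - christoffel h d b e x * christoffel h e a c x).

(* Components of R(u, v) w in the chart [h], for [u], [v], [w] tangent at [x]. *)
Definition riemann (h : chart M) (x : M) (u v w : 'rV[R]_n) : 'rV[R]_n :=
  let J := chart_comp h x in
  \row_d \sum_a \sum_b \sum_c
    (u *m J) 0 a * (v *m J) 0 b * (w *m J) 0 c * riemann_comp h d c a b x.

Definition constant_curvature (k : R) : Prop :=
  forall (h : chart M) (x : M) (u v w : 'rV[R]_n), dom h x ->
    riemann h x u v w =
    (k *: (gbar x v w *: u - gbar x u w *: v)) *m chart_comp h x.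

(* [nb X V] is the covariant derivative over [U], for the Levi-Civita
   connection of the ambient manifold, of the section [V] of the pull-back
   bundle f^*TM in the direction of the vector field [X] on the source; it is
   specified by its components in all the charts of the ambient manifold. *)
Definition levi_civita_along m (M0 : manifold R m) (f : M0 -> M) (U : set M0)
    (nb : (M0 -> 'rV[R]_m) -> (M0 -> 'rV[R]_n) -> (M0 -> 'rV[R]_n)) : Prop :=
  forall X V, smooth_field U X -> smooth_along f U V ->
  forall (p : M0) (a : chart M), U p -> dom a (f p) ->
    comp_along f (nb X V) a p =
    tderive p (X p) (comp_along f V a)
    + \row_c \sum_b \sum_d christoffel a c b d (f p)
        * comp_along f (push f X) a p 0 b * comp_along f V a p 0 d.

Definition perp k (x : M) (W : 'M[R]_(k, n)) : 'M[R]_n := kermx (G x *m W^T).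

Definition nondegenerate k (x : M) (W : 'M[R]_(k, n)) : Prop :=
  (W :&: perp x W)%MS = 0.

End Semi_Riemannian.

Definition complement_in {R : realType} {n k} (A B : 'M[R]_n) (C : 'M[R]_(k, n))
    : Prop :=
  (A + B == C)%MS /\ (A :&: B)%MS = 0.

Section Half_lightlike.
Context {R : realType} {m : nat} {M : manifold R m} {Mb : manifold R m.+2}.
Variables (G : Mb -> 'M[R]_m.+2) (iota : M -> Mb).

Definition gind (p : M) (v w : 'rV[R]_m) : R :=
  gbar G (iota p) (v *m tangent_map iota p) (w *m tangent_map iota p).

Definition normal_space (p : M) : 'M[R]_m.+2 :=
  perp G (iota p) (tangent_map iota p).

(* Rad(TM) at [p], as a subspace of the tangent space of M: the vectors [v]
   whose image by the differential of [iota] is in the normal space. *)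
Definition rad (p : M) : 'M[R]_m :=
  kermx (tangent_map iota p *m (G (iota p) *m (tangent_map iota p)^T)).

(* Rad(TM) at [p], as a subspace of the ambient tangent space. *)
Definition rad_amb (p : M) : 'M[R]_m.+2 :=
  (tangent_map iota p :&: normal_space p)%MS.

Definition half_lightlike : Prop :=
  immersed_submanifold iota /\ forall p, \rank (rad_amb p) = 1%N.

Definition screen (S : M -> 'M[R]_m) : Prop :=
  smooth_distribution (fun p : M => p) m.-1 S /\
  forall p, complement_in (S p) (rad p) (1%:M : 'M[R]_m) /\
            nondegenerate G (iota p) (S p *m tangent_map iota p).

Definition coscreen (K : M -> 'M[R]_m.+2) : Prop :=
  smooth_distribution iota 1 K /\
  forall p, complement_in (K p) (rad_amb p) (normal_space p) /\
            nondegenerate G (iota p) (K p).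

Definition section_of n (U : set M) (S : M -> 'M[R]_n) (X : M -> 'rV[R]_n)
    : Prop :=
  forall p, U p -> (X p <= S p)%MS.

Definition screen_proj (S : M -> 'M[R]_m) (Y : M -> 'rV[R]_m)
    : M -> 'rV[R]_m :=
  fun p => Y p *m proj_mx (S p) (rad p).

(* Local frame fields over [U]: [xi] spans Rad(TM), [L] is a unit section of
   the co-screen, and [N] is the associated null transversal section. *)
Definition adapted_fields (S : M -> 'M[R]_m) (K : M -> 'M[R]_m.+2) (U : set M)
    (xi : M -> 'rV[R]_m) (N L : M -> 'rV[R]_m.+2) : Prop :=
  [/\ smooth_field U xi /\ section_of U rad xi,
      forall p, U p -> xi p != 0,
      [/\ smooth_along iota U L, section_of U K L &
          forall p, U p -> gbar G (iota p) (L p) (L p) = 1] &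
      smooth_along iota U N /\
      forall p, U p ->
        [/\ (N p <= perp G (iota p) (S p *m tangent_map iota p + K p)%MS)%MS,
            gbar G (iota p) (N p) (N p) = 0 &
            gbar G (iota p) (push iota xi p) (N p) = 1]].

Notation field := (M -> 'rV[R]_m).

Record induced_objects := InducedObjects {
  nabla : field -> field -> field;
  fundB : field -> field -> M -> R;
  fundD : field -> field -> M -> R;
  shapeN : field -> field;
  tau : field -> M -> R;
  rho : field -> M -> R;
  shapeL : field -> field;
  phi : field -> M -> R;
  nablaS : field -> field -> field;
  fundC : field -> field -> M -> R;
  shapeX : field -> field }.

(* [nb] is the Levi-Civita connection of the ambient manifold along [iota];
   [shapeX] is the screen shape operator of [xi]. *)
Definition gauss_weingarten (S : M -> 'M[R]_m) (U : set M)
    (xi : field) (N L : M -> 'rV[R]_m.+2)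
    (nb : field -> (M -> 'rV[R]_m.+2) -> (M -> 'rV[R]_m.+2))
    (I : induced_objects) : Prop :=
  forall X Y : field, smooth_field U X -> smooth_field U Y ->
  let PY := screen_proj S Y in
  [/\ section_of U S (nablaS I X PY),
      section_of U S (shapeX I X) &
  forall p, U p ->
    [/\ nb X (push iota Y) p =
          push iota (nabla I X Y) p + fundB I X Y p *: N p
          + fundD I X Y p *: L p,
        nb X N p =
          - push iota (shapeN I X) p + tau I X p *: N p + rho I X p *: L p,
        nb X L p = - push iota (shapeL I X) p + phi I X p *: N p,
        nabla I X PY p = nablaS I X PY p + fundC I X PY p *: xi p &
        nabla I X xi p = - shapeX I X p - tau I X p *: xi p]].

Definition irrotational (U : set M) (xi : field)
    (nb : field -> (M -> 'rV[R]_m.+2) -> (M -> 'rV[R]_m.+2)) : Prop :=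
  forall X, smooth_field U X -> forall p, U p ->
    (nb X (push iota xi) p <= tangent_map iota p)%MS.

Definition constant_along_screen (S : M -> 'M[R]_m) (U : set M) (f : M -> R)
    : Prop :=
  forall W, smooth_field U W -> section_of U S W ->
  forall p, U p -> tderive p (W p) f = 0.

Definition screen_conformal (U : set M) (I : induced_objects) (cf : M -> R)
    : Prop :=
  [/\ smooth_fun U cf, forall p, U p -> cf p != 0 &
      forall X, smooth_field U X ->
      forall p, U p -> shapeN I X p = cf p *: shapeX I X p].

End Half_lightlike.

(* Main.v *)
(** Write G_ij^l = g(nabla_{E_i} E_j, E_l).  As M is irrotational and tau = 0,
    the ambient derivative of xi along E_i is - lambda_i E_i, and as the lambda_i
    are constant along S(TM), the curvature identity R(E_i, E_j) xi = 0 reduces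
    to the Codazzi equations
    (lambda_j - lambda_l) G_ij^l = (lambda_i - lambda_l) G_ji^l.
    They kill the G_ij^l for which lambda_i = lambda_l <> lambda_j, and hence
    the derivative terms of R(E_i, E_j, E_j, E_i) = k when lambda_i <> lambda_j.
    The numerator of the summand of index j thus becomes a sum over l of
    2 t_ijl^2 / ((lambda_j - lambda_l) (lambda_i - lambda_l)), with t_ijl^2
    symmetric in its indices; once divided by lambda_i - lambda_j it is
    antisymmetric in j and l, and the double sum over j and l vanishes.
    All differential identities are checked in one chart of M and one of the
    ambient manifold. *)

(* The lambda_i are not assumed constant along xi, while the bracket of E_i and E_j may have a
   xi-component. In R(E_i, E_j, E_j, E_i) this component meets g(nabla_xi E_j, E_i), removed by a
   second use of constant curvature: R(xi, E_j) xi = 0 makes it vanish when lambda_i <> lambda_j,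
   since the derivative of lambda_j along xi multiplies only E_j. The vanishing of a coefficient at
   one point says nothing of its derivatives. It is used on the whole open set where lambda_i <>
   lambda_j, so eigenvalues are allowed to collide elsewhere. As g is degenerate, products of
   ambient derivatives are expanded in the frame E_l, xi, N, L, where xi and N are dual to each
   other: their cross terms produce the A_N terms, and L the A_L terms. The ambient connection is
   given on fields and specified by components in charts. In a pair of charts it becomes an operator
   taking a direction vector at each point, which makes its tensoriality and its iteration
   available. *)
From Pilot Require Import Defs.
From mathcomp Require Import all_boot all_order all_algebra.
From mathcomp Require Import all_classical all_reals all_analysis.
From mathcomp Require Import ring lra.
Import Order.TTheory GRing.Theory Num.Theory.
Import numFieldNormedType.Exports.
Import Pilot.Defs. (* restores [coord], hidden by mathcomp's vector library *)
Set Implicit Arguments.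
Unset Strict Implicit.
Unset Printing Implicit Defensive.
Local Open Scope classical_set_scope.
Local Open Scope ring_scope.

(** * Smooth functions *)

Section Near_equality.
Context {R : realType} {V W : normedModType R}.
Implicit Types f g : V -> W.

Lemma open_nearW (O : set V) (P : V -> Prop) (x : V) :
  open O -> O x -> (forall y, O y -> P y) -> \forall y \near x, P y.
Proof.
move=> oO Ox OP; have : \forall y \near x, O y by exact: open_nbhs_nbhs.
exact: filterS.
Qed.

(** The difference [g - f] is zero near [x], hence has the first-order expansion with zero
    differential there; [g] is then the sum of [f] and a differentiable function. *)
Lemma near_eq_differentiable f g (x : V) :
  (\forall y \near x, f y = g y) -> differentiable f x -> differentiable g x.
Proof.
move=> fg df.
suff dh : differentiable (g - f) x.
  rewrite (_ : g = f + (g - f)); first exact: differentiableD.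
  by rewrite addrC subrK.
have hx : (g - f) x = 0.
  by rewrite /= !fctE (nbhs_singleton fg) subrr.
have key : (g - f) \o shift x = cst ((g - f) x) + (0 : V -> W) +o_ 0 id.
  apply/eqaddoP => e e0; rewrite hx.
  have : \forall y \near (0 : V), f (y + x) = g (y + x).
    by have := fg; rewrite (near_shift 0 x) /= subr0.
  apply: filterS => y /= ey.
  by rewrite !fctE /= ey subrr !addr0 oppr0 !addr0 normr0 mulr_ge0 // ltW.
have c0 : continuous (\0 : V -> W) by move=> ?; exact: cst_continuous.
apply/diff_locallyP; rewrite (diff_unique (df := \0) c0); last exact: key.
by split => //; exact: key.
Qed.

Lemma open_eq_derive (O : set V) f g (x v : V) :
  open O -> O x -> (forall y, O y -> f y = g y) -> 'D_v f x = 'D_v g x.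
Proof. by move=> oO Ox fg; apply: near_eq_derive; exact: open_nearW fg. Qed.

Lemma open_eq_differentiable (O : set V) f g (x : V) :
  open O -> O x -> (forall y, O y -> f y = g y) ->
  differentiable f x -> differentiable g x.
Proof.
by move=> oO Ox fg; apply: near_eq_differentiable; exact: open_nearW fg.
Qed.

End Near_equality.

Section Smooth_algebra.
Context {R : realType} {V : normedModType R}.
Implicit Types (O : set V) (x u v : V).

Lemma iter_derive_rcons (W : normedModType R) (F : V -> W) vs v :
  iter_derive F (rcons vs v) = iter_derive ('D_v F) vs.
Proof. by rewrite /iter_derive foldr_rcons. Qed.

Lemma smooth_on_differentiable (W : normedModType R) O (F : V -> W) x :
  smooth_on O F -> O x -> differentiable F x.
Proof. by move=> sF; apply: (sF [::]). Qed.

Lemma smooth_on_derive (W : normedModType R) O (F : V -> W) v :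
  smooth_on O F -> smooth_on O ('D_v F).
Proof. by move=> sF vs x Ox; rewrite -iter_derive_rcons; exact: sF. Qed.

Lemma smooth_on_sub (W : normedModType R) O O' (F : V -> W) :
  O' `<=` O -> smooth_on O F -> smooth_on O' F.
Proof. by move=> sO sF vs x /sO; exact: sF. Qed.

Lemma iter_derive_open_eq (W : normedModType R) O (F F' : V -> W) vs x :
  open O -> (forall y, O y -> F y = F' y) -> O x ->
  iter_derive F vs x = iter_derive F' vs x.
Proof.
move=> oO FF'; elim: vs x => [|v vs IH] x Ox /=; first exact: FF'.
exact: open_eq_derive IH.
Qed.

Lemma smooth_on_eq (W : normedModType R) O (F F' : V -> W) :
  open O -> (forall y, O y -> F y = F' y) -> smooth_on O F -> smooth_on O F'.
Proof.
move=> oO FF' sF vs x Ox; apply: (open_eq_differentiable oO Ox _ (sF vs x Ox)).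
by move=> y Oy; exact: (iter_derive_open_eq _ oO FF').
Qed.

(* The algebra generated by the smooth functions is stable under 'D_v, hence
   consists of smooth functions. *)
Inductive smooth_generated O : (V -> R) -> Prop :=
| smooth_gen F : smooth_on O F -> smooth_generated O F
| smooth_add F F' : smooth_generated O F -> smooth_generated O F' ->
    smooth_generated O (F + F')
| smooth_mul F F' : smooth_generated O F -> smooth_generated O F' ->
    smooth_generated O (F * F').

Lemma smooth_generated_differentiable O F x :
  smooth_generated O F -> O x -> differentiable F x.
Proof.
move=> gF Ox; elim: gF => {F} [F sF|F F' _ dF _ dF'|F F' _ dF _ dF'].
- exact: smooth_on_differentiable Ox.
- exact: differentiableD.
- exact: differentiableM.
Qed.

(** The sum and product rules need differentiability, known on [O] only, so the derivative is a
    generated function up to equality on [O]. *)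
Lemma smooth_generated_derive O F v :
  smooth_generated O F -> exists2 F', smooth_generated O F' &
    forall x, O x -> 'D_v F x = F' x.
Proof.
elim=> {F} [F sF|F G gF [F' gF' eF] gG [G' gG' eG]|F G gF [F' gF' eF] gG [G' gG' eG]].
- exists ('D_v F) => //; by apply: smooth_gen; exact: smooth_on_derive.
- exists (F' + G'); first exact: smooth_add.
  move=> x Ox; rewrite deriveD; last 2 first.
    exact/diff_derivable/(smooth_generated_differentiable gF).
    exact/diff_derivable/(smooth_generated_differentiable gG).
  by rewrite eF// eG.
- exists (F * G' + G * F').
    by apply: smooth_add; apply: smooth_mul.
  move=> x Ox; rewrite deriveM; last 2 first.
    exact/diff_derivable/(smooth_generated_differentiable gF).
    exact/diff_derivable/(smooth_generated_differentiable gG).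
  by rewrite eF// eG.
Qed.

Lemma smooth_generated_smooth O F :
  open O -> smooth_generated O F -> smooth_on O F.
Proof.
move=> oO gF vs x Ox.
suff [F' gF' eF] : exists2 F', smooth_generated O F' &
    forall x, O x -> iter_derive F vs x = F' x.
  apply: (@open_eq_differentiable _ _ _ _ F' _ _ oO Ox) => [y Oy|].
    by rewrite eF.
  exact: smooth_generated_differentiable gF' Ox.
elim: vs => [|v vs [G gG eG]] /=; first by exists F.
have [F' gF' eF] := smooth_generated_derive v gG.
exists F' => // y Oy; rewrite -eF//.
exact: (open_eq_derive _ oO Oy eG).
Qed.

Lemma smooth_on_cst O (c : R) : smooth_on O (cst c : V -> R).
Proof.
move=> vs x Ox; have [d ->] : exists d : R, iter_derive (cst c : V -> R) vs = cst d.
  elim: vs => [|v vs [d /= ->]]; first by exists c.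
  by exists 0; apply/funext => y; rewrite derive_cst.
exact: differentiable_cst.
Qed.

Lemma smooth_onM O (F F' : V -> R) : open O ->
  smooth_on O F -> smooth_on O F' -> smooth_on O (fun x => F x * F' x).
Proof.
move=> oO sF sF'; apply: (@smooth_generated_smooth O (F * F')) => //.
by apply: smooth_mul; exact: smooth_gen.
Qed.

Lemma smooth_onD O (F F' : V -> R) : open O ->
  smooth_on O F -> smooth_on O F' -> smooth_on O (fun x => F x + F' x).
Proof.
move=> oO sF sF'; apply: (@smooth_generated_smooth O (F + F')) => //.
by apply: smooth_add; exact: smooth_gen.
Qed.

Lemma smooth_on_sum (J : Type) (s : seq J) O (F : J -> V -> R) : open O ->
  (forall j, smooth_on O (F j)) -> smooth_on O (fun x => \sum_(j <- s) F j x).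
Proof.
move=> oO sF; elim: s => [|j s IH].
  by under eq_fun do rewrite big_nil; exact: smooth_on_cst.
by under eq_fun do rewrite big_cons; exact: smooth_onD.
Qed.

End Smooth_algebra.

(** * Smoothness of matrix-valued functions through their entries *)

Section Matrix_valued.
Context {R : realType} {V : normedModType R}.
Implicit Types (O : set V) (x u v : V).

Lemma differentiable_coordP n p (F : V -> 'M[R]_(n, p)) x :
  differentiable F x <-> forall i j, differentiable (fun y => F y i j) x.
Proof.
split=> [dF i j|dF].
  exact: (differentiable_comp dF (differentiable_coord (F x) i j)).
rewrite (_ : F = \sum_(i < n) \sum_(j < p)
    (fun y => F y i j *: (delta_mx i j : 'M[R]_(n, p)))); last first.
  apply/funext => y; rewrite [LHS]matrix_sum_delta fct_sumE.
  by apply: eq_bigr => i _; rewrite fct_sumE.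
by do 2 (apply: differentiable_sum => ?); exact: differentiableZl.
Qed.

Lemma derive_coord n p (F : V -> 'M[R]_(n, p)) x v i j : differentiable F x ->
  ('D_v F x) i j = 'D_v (fun y => F y i j) x.
Proof. by move=> dF; rewrite derive_mx ?mxE//; exact: diff_derivable. Qed.

(** Differentiability is demanded only for words shorter than [vs], which is what the strong
    induction on the length of [vs] in [smooth_on_coord] can supply. *)
Lemma iter_derive_coord n p O (F : V -> 'M[R]_(n, p)) vs x i j : open O ->
  (forall ws y, (size ws < size vs)%N -> O y -> differentiable (iter_derive F ws) y) ->
  O x ->
  iter_derive (fun y => F y i j) vs x = iter_derive F vs x i j.
Proof.
move=> oO; elim: vs x => [//|v vs IH] x sF Ox /=.
rewrite derive_coord; last exact: (sF vs).
apply: (open_eq_derive _ oO Ox) => y Oy; apply: IH => // ws z sws.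
by apply: sF; rewrite (leq_trans sws)/=.
Qed.

Lemma smooth_on_coord n p O (F : V -> 'M[R]_(n, p)) : open O ->
  (smooth_on O F <-> forall i j, smooth_on O (fun y => F y i j)).
Proof.
move=> oO; split=> [sF i j vs x Ox|sF vs x].
  apply: (@open_eq_differentiable _ _ _ _ (fun y => iter_derive F vs y i j)
            _ _ oO Ox).
    by move=> y Oy; rewrite (iter_derive_coord _ _ oO)// => *; exact: sF.
  exact: (differentiable_coordP _ _).1 (sF vs x Ox) i j.
have [k le_k] := ubnP (size vs); elim: k => // k IH in vs x le_k *.
move=> Ox; apply/differentiable_coordP => i j.
apply: (@open_eq_differentiable _ _ _ _ (iter_derive (fun y => F y i j) vs)
          _ _ oO Ox); last exact: sF.
move=> y Oy; rewrite (iter_derive_coord _ _ oO)// => ws z sws Oz.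
by apply: IH => //; rewrite (leq_trans sws).
Qed.

End Matrix_valued.

(** * Symmetry of second derivatives *)

Section Symmetry_of_second_derivatives.
Context {R : realType} {V : normedModType R}.
Implicit Types (F : V -> R) (x y u v : V).

Lemma is_derive_line F y u (t : R) : differentiable F (y + t *: u) ->
  is_derive t 1 (fun s : R => F (y + s *: u)) ('D_u F (y + t *: u)).
Proof.
move=> dF.
have dl : is_diff t (fun s : R => y + s *: u) (fun s => s *: u).
  have := is_diffD (is_diff_cst y t) (is_diff_scalel t u).
  by rewrite add0r.
have dlt : differentiable (fun s : R => y + s *: u) t by exact: ex_diff.
have dFl : differentiable (F \o (fun s : R => y + s *: u)) t.
  exact: differentiable_comp.
split; first exact: diff_derivable.
rewrite (deriveE _ dFl) diff_comp //.
by rewrite /= diff_val scale1r -deriveE.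
Qed.

Lemma mean_value_line F y u (h : R) : 0 < h ->
  (forall t, 0 <= t <= h -> differentiable F (y + t *: u)) ->
  exists2 t, 0 <= t <= h & F (y + h *: u) - F y = h * 'D_u F (y + t *: u).
Proof.
move=> h0 dF.
have [||t] := @MVT R (fun s => F (y + s *: u)) (fun s => 'D_u F (y + s *: u)) 0 h h0.
- move=> t; rewrite in_itv /= => /andP[t0 th]; apply: is_derive_line.
  by apply: dF; rewrite !ltW.
- apply: continuous_in_subspaceT => t; rewrite inE /= in_itv /= => /dF dFt.
  apply: differentiable_continuous; apply/derivable1_diffP.
  by have [] := is_derive_line dFt.
rewrite in_itv /= => /andP[t0 th]; rewrite scale0r addr0 subr0 mulrC => eF.
by exists t; rewrite ?ltW.
Qed.

(** The mean value theorem is used twice: in [s], for the difference [G] of [F] on two parallel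
    segments directed by [u], then along [v] for ['D_u F]. *)
Lemma second_difference F x u v (h : R) : 0 < h ->
  (forall s t, 0 <= s <= h -> 0 <= t <= h ->
     differentiable F (x + s *: u + t *: v) /\
     differentiable ('D_u F) (x + s *: u + t *: v)) ->
  exists s t, [/\ 0 <= s <= h, 0 <= t <= h &
    F (x + h *: u + h *: v) - F (x + h *: u) - F (x + h *: v) + F x =
    h ^+ 2 * 'D_v ('D_u F) (x + s *: u + t *: v)].
Proof.
move=> h0 dF.
have h00 : (0 <= (0 : R) <= h) by rewrite lexx ltW.
have hh : (0 <= h <= h) by rewrite lexx ltW.
pose G := fun s : R => F (x + h *: v + s *: u) - F (x + s *: u).
pose dG := fun s : R => 'D_u F (x + h *: v + s *: u) - 'D_u F (x + s *: u).
have isG s : 0 <= s <= h -> is_derive s 1 G (dG s).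
  move=> hs; apply: is_deriveB; apply: is_derive_line.
    by have [] := dF _ _ hs hh; rewrite addrAC.
  by have [] := dF _ _ hs h00; rewrite scale0r addr0.
have [||s] := @MVT R G dG 0 h h0.
- by move=> s; rewrite in_itv /= => /andP[s0 sh]; apply: isG; rewrite !ltW.
- apply: continuous_in_subspaceT => t; rewrite inE /= in_itv /= => /isG [dt _].
  by apply: differentiable_continuous; apply/derivable1_diffP.
rewrite in_itv /= => /andP[s0 sh]; rewrite subr0 => eG.
have hs : 0 <= s <= h by rewrite !ltW.
have [t ht et] := @mean_value_line ('D_u F) (x + s *: u) v h h0
  (fun t ht => (dF s t hs ht).2).
exists s, t; split => //.
rewrite expr2 -mulrA -et [x + s *: u + _]addrAC -/(dG s) mulrC -eG /G.
by rewrite scale0r !addr0 [x + h *: u + _]addrAC; ring.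
Qed.

Lemma midpoint_separation (a b c : R) :
  `|a - c| < `|a - b| / 2 -> `|b - c| < `|a - b| / 2 -> False.
Proof. by have := ler_distD c a b; rewrite [X in _ <= _ + X]distrC; lra. Qed.

(** The second difference over a parallelogram is symmetric in [u] and [v], so the two mixed
    derivatives take a common value at two points near [x]. By continuity, their values at [x] are
    both closer to that common value than half of their distance [e], which is absurd. *)
Lemma derive_sym (O : set V) F x u v : open O -> smooth_on O F -> O x ->
  'D_u ('D_v F) x = 'D_v ('D_u F) x.
Proof.
move=> oO sF Ox; apply/eqP; rewrite -subr_eq0 -normr_eq0; apply/negP => /negP n0.
set e := `|_| in n0; have e0 : 0 < e by rewrite lt_def n0 normr_ge0.
have cA : {for x, continuous ('D_u ('D_v F))}.
  by apply/differentiable_continuous/(smooth_on_differentiable _ Ox);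
     do 2 apply: smooth_on_derive.
have cB : {for x, continuous ('D_v ('D_u F))}.
  by apply/differentiable_continuous/(smooth_on_differentiable _ Ox);
     do 2 apply: smooth_on_derive.
have e20 : 0 < e / 2 by rewrite divr_gt0.
have : \forall y \near x, [/\ O y, `|'D_u ('D_v F) x - 'D_u ('D_v F) y| < e / 2 &
                        `|'D_v ('D_u F) x - 'D_v ('D_u F) y| < e / 2].
  have nO : \forall y \near x, O y by exact: open_nbhs_nbhs.
  have nA : \forall y \near x, `|'D_u ('D_v F) x - 'D_u ('D_v F) y| < e / 2.
    exact: (cvgrPdist_lt _ _).1 cA _ e20.
  have nB : \forall y \near x, `|'D_v ('D_u F) x - 'D_v ('D_u F) y| < e / 2.
    exact: (cvgrPdist_lt _ _).1 cB _ e20.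
  by move: nO nA nB; apply: filterS3 => y; exact: And3.
move/nbhs_ballP => [d /= d0 bd].
(* With this side length the parallelogram on [h *: u] and [h *: v] stays in the ball of radius [d];
   the [+ 1] keeps the denominator positive when [u] and [v] are zero. *)
pose h := d / 2 / (`|u| + `|v| + 1).
have uv0 : 0 < `|u| + `|v| + 1 by rewrite ltr_wpDl ?addr_ge0.
have h0 : 0 < h by rewrite !divr_gt0.
have inb s t : 0 <= s <= h -> 0 <= t <= h -> ball x d (x + s *: u + t *: v).
  move=> /andP[s0 sh] /andP[t0 th]; rewrite -ball_normE /ball_ /=.
  rewrite -addrA opprD addrA subrr add0r normrN (le_lt_trans (ler_normD _ _))//.
  rewrite !normrZ !ger0_norm//.
  apply: (@le_lt_trans _ _ (h * (`|u| + `|v|))).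
    by rewrite mulrDr lerD// ler_wpM2r.
  apply: (@le_lt_trans _ _ (d / 2)); last by rewrite ltr_pdivrMr// ltr_pMr// ltr1n.
  by rewrite /h -mulrA ler_piMr ?divr_ge0 ?(ltW d0)// mulrC ler_pdivrMr// mul1r lerDl.
have dO s t : 0 <= s <= h -> 0 <= t <= h -> O (x + s *: u + t *: v).
  by move=> hs ht; have [] := bd _ (inb s t hs ht).
have [s [t [hs ht e1]]] := @second_difference F x u v h h0
  (fun s t hs ht => conj (smooth_on_differentiable sF (dO s t hs ht))
     (smooth_on_differentiable (smooth_on_derive u sF) (dO s t hs ht))).
have dO' s' t' : 0 <= s' <= h -> 0 <= t' <= h -> O (x + s' *: v + t' *: u).
  by move=> hs' ht'; rewrite addrAC; exact: dO.
have [s' [t' [hs' ht' e2]]] := @second_difference F x v u h h0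
  (fun s t hs ht => conj (smooth_on_differentiable sF (dO' s t hs ht))
     (smooth_on_differentiable (smooth_on_derive v sF) (dO' s t hs ht))).
have h20 : h ^+ 2 != 0 by rewrite expf_neq0// gt_eqF.
have ee : 'D_v ('D_u F) (x + s *: u + t *: v) = 'D_u ('D_v F) (x + s' *: v + t' *: u).
  apply: (mulfI h20).
  apply: etrans (esym e1) _.
  apply: etrans e2.
  rewrite (addrAC x (h *: v)).
  congr (_ + _).
  exact: addrAC.
have [_ _ lB] := bd _ (inb s t hs ht).
have [_ lA _] := bd _ (inb t' s' ht' hs').
rewrite [x + t' *: u + _]addrAC in lA; rewrite ee in lB.
exact: midpoint_separation lA lB.
Qed.

End Symmetry_of_second_derivatives.

(** * Determinants and inverses of differentiable matrices *)

Section Inverse_matrix.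
Context {R : realType} {V : normedModType R}.

Lemma differentiable_mul (F G : V -> R) x :
  differentiable F x -> differentiable G x ->
  differentiable (fun y => F y * G y) x.
Proof. exact: differentiableM. Qed.

Lemma differentiable_add (W : normedModType R) (F G : V -> W) x :
  differentiable F x -> differentiable G x ->
  differentiable (fun y => F y + G y) x.
Proof. exact: differentiableD. Qed.

Lemma differentiable_prod (J : Type) (s : seq J) (F : J -> V -> R) x :
  (forall j, differentiable (F j) x) ->
  differentiable (fun y => \prod_(j <- s) F j y) x.
Proof.
move=> dF; elim: s => [|j s IH].
  by under eq_fun do rewrite big_nil; exact: differentiable_cst.
under eq_fun do rewrite big_cons.
exact: differentiable_mul.
Qed.

Lemma differentiable_bigsum (J : Type) (s : seq J) (F : J -> V -> R) x :
  (forall j, differentiable (F j) x) ->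
  differentiable (fun y => \sum_(j <- s) F j y) x.
Proof.
move=> dF; elim: s => [|j s IH].
  by under eq_fun do rewrite big_nil; exact: differentiable_cst.
under eq_fun do rewrite big_cons.
exact: differentiable_add.
Qed.

Lemma differentiable_det n (A : V -> 'M[R]_n) x :
  differentiable A x -> differentiable (fun y => \det (A y)) x.
Proof.
move=> dA; rewrite /determinant; apply: differentiable_bigsum => s.
apply: differentiable_mul; first exact: differentiable_cst.
by apply: differentiable_prod => i; exact: (differentiable_coordP _ _).1.
Qed.

(** [invmx] is given by the adjugate on invertible matrices and leaves the others unchanged; the
    openness of [O] makes the adjugate formula valid around [x]. *)
Lemma differentiable_invmx n (A : V -> 'M[R]_n) (O : set V) x :
  open O -> O x -> (forall y, O y -> A y \in unitmx) ->
  differentiable A x -> differentiable (fun y => invmx (A y)) x.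
Proof.
move=> oO Ox uA dA.
apply: (@open_eq_differentiable _ _ _ O
  (fun y => (\det (A y))^-1 *: \adj (A y))) => //.
  by move=> y /uA Ay; rewrite /invmx Ay.
apply/differentiable_coordP => i j; under eq_fun do rewrite !mxE.
have dC : differentiable (fun y => cofactor (A y) j i) x.
  rewrite /cofactor; apply: differentiable_mul; first exact: differentiable_cst.
  apply: differentiable_det; apply/differentiable_coordP => k l.
  by under eq_fun do rewrite !mxE; exact: (differentiable_coordP _ _).1.
apply: differentiable_mul => //.
apply: differentiableV; first exact: differentiable_det.
by rewrite -unitfE -unitmxE uA.
Qed.

End Inverse_matrix.

(** * Levi-Civita connection along a map between open sets *)

Section Matrix_calculus.
Context {R : realType} {V : normedModType R}.
Implicit Types (x u : V).

Lemma derive_bigsum (J : Type) (s : seq J) (F : J -> V -> R) x u :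
  (forall j, differentiable (F j) x) ->
  'D_u (fun y => \sum_(j <- s) F j y) x = \sum_(j <- s) 'D_u (F j) x.
Proof.
move=> dF; elim: s => [|j s IH].
  under eq_fun do rewrite big_nil.
  by rewrite big_nil; exact: derive_cst.
under eq_fun do rewrite big_cons.
rewrite big_cons -IH; apply: (@deriveD _ _ _ (F j) (fun y => \sum_(j <- s) F j y)).
  exact: diff_derivable.
by apply: diff_derivable; exact: differentiable_bigsum.
Qed.

Lemma derive_mul (F G : V -> R) x u : differentiable F x -> differentiable G x ->
  'D_u (fun y => F y * G y) x = 'D_u F x * G x + F x * 'D_u G x.
Proof.
move=> dF dG.
rewrite (_ : (fun y => _) = F * G)// deriveM; try exact: diff_derivable.
by rewrite addrC /GRing.scale /= mulrC.
Qed.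

Lemma derive_add (W : normedModType R) (F G : V -> W) x u :
  differentiable F x -> differentiable G x ->
  'D_u (fun y => F y + G y) x = 'D_u F x + 'D_u G x.
Proof. by move=> dF dG; apply: deriveD; exact: diff_derivable. Qed.

Lemma differentiable_mulmx p q r (A : V -> 'M[R]_(p, q)) (B : V -> 'M[R]_(q, r)) x :
  differentiable A x -> differentiable B x ->
  differentiable (fun y => A y *m B y) x.
Proof.
move=> dA dB; apply/differentiable_coordP => i j.
under eq_fun do rewrite mxE; apply: differentiable_bigsum => k.
by apply: differentiable_mul; exact: (differentiable_coordP _ _).1.
Qed.

Lemma derive_mulmx p q r (A : V -> 'M[R]_(p, q)) (B : V -> 'M[R]_(q, r)) x u :
  differentiable A x -> differentiable B x ->
  'D_u (fun y => A y *m B y) x = 'D_u A x *m B x + A x *m 'D_u B x.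
Proof.
move=> dA dB; apply/matrixP => i j.
rewrite derive_coord; last exact: differentiable_mulmx.
under eq_fun do rewrite mxE.
have dAij k l := (differentiable_coordP _ _).1 dA k l.
have dBij k l := (differentiable_coordP _ _).1 dB k l.
rewrite derive_bigsum; last by move=> k; exact: differentiable_mul.
rewrite !mxE -big_split; apply: eq_bigr => k _ /=.
by rewrite derive_mul// !derive_coord.
Qed.

Lemma differentiable_trmx p q (A : V -> 'M[R]_(p, q)) x :
  differentiable A x -> differentiable (fun y => (A y)^T) x.
Proof.
move=> dA; apply/differentiable_coordP => i j; under eq_fun do rewrite mxE.
exact: (differentiable_coordP _ _).1.
Qed.

Lemma derive_trmx p q (A : V -> 'M[R]_(p, q)) x u :
  differentiable A x -> 'D_u (fun y => (A y)^T) x = ('D_u A x)^T.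
Proof.
move=> dA; apply/matrixP => i j; rewrite derive_coord; last exact: differentiable_trmx.
by under eq_fun do rewrite mxE; rewrite mxE derive_coord.
Qed.

Lemma derive_sym_mx (O : set V) p q (A : V -> 'M[R]_(p, q)) x u v :
  open O -> smooth_on O A -> O x -> 'D_u ('D_v A) x = 'D_v ('D_u A) x.
Proof.
move=> oO sA Ox; apply/matrixP => i j.
have E w w' : ('D_w ('D_w' A) x) i j = 'D_w ('D_w' (fun y => A y i j)) x.
  rewrite derive_coord; last first.
    by apply: smooth_on_differentiable Ox; exact: smooth_on_derive.
  apply: (open_eq_derive _ oO Ox) => y Oy.
  by rewrite derive_coord//; exact: smooth_on_differentiable Oy.
have sAij := (smooth_on_coord A oO).1 sA i j.
have e := (derive_sym u v oO sAij Ox).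
exact: (etrans (E u v) (etrans e (esym (E v u)))).
Qed.

End Matrix_calculus.

Section Directional_expansion.
Context {R : realType} {n : nat}.

Lemma derive_row_expand (W : normedModType R) (F : 'rV[R]_n -> W) x u :
  differentiable F x ->
  'D_u F x = \sum_a u 0 a *: 'D_(delta_mx 0 a) F x.
Proof.
move=> dF; rewrite deriveE// [in LHS](row_sum_delta u) linear_sum.
by apply: eq_bigr => a _; rewrite linearZ/= deriveE.
Qed.

Lemma derive_comp_expand (V : normedModType R) (f : V -> 'rV[R]_n)
  (h : 'rV[R]_n -> R) x u : differentiable f x -> differentiable h (f x) ->
  'D_u (h \o f) x = \sum_b 'D_u f x 0 b * 'D_(delta_mx 0 b) h (f x).
Proof.
move=> df dh; rewrite deriveE; last exact: differentiable_comp.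
by rewrite diff_comp//= -!deriveE// derive_row_expand.
Qed.

End Directional_expansion.

Definition inner {R : realType} {n : nat} (A : 'M[R]_n) (v w : 'rV[R]_n) : R :=
  (v *m A *m w^T) 0 0.

Section Inner.
Context {R : realType} {n : nat} (A : 'M[R]_n).
Implicit Types v w : 'rV[R]_n.

Lemma innerDl v v' w : inner A (v + v') w = inner A v w + inner A v' w.
Proof. by rewrite /inner !mulmxDl mxE. Qed.

Lemma innerZl c v w : inner A (c *: v) w = c * inner A v w.
Proof. by rewrite /inner -!scalemxAl mxE. Qed.

Lemma innerNl v w : inner A (- v) w = - inner A v w.
Proof. by rewrite -scaleN1r innerZl mulN1r. Qed.

Lemma inner0l w : inner A 0 w = 0.
Proof. by rewrite -(scale0r 0) innerZl mul0r. Qed.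

Lemma inner_suml (J : finType) (F : J -> 'rV[R]_n) w :
  inner A (\sum_j F j) w = \sum_j inner A (F j) w.
Proof.
apply: (big_morph (fun v => inner A v w)) => [v v'|]; last exact: inner0l.
exact: innerDl.
Qed.

Lemma inner_sym v w : A^T = A -> inner A v w = inner A w v.
Proof.
move=> sA; rewrite /inner; have -> : v *m A *m w^T = (w *m A *m v^T)^T.
  by rewrite !trmx_mul trmxK sA mulmxA.
by rewrite mxE.
Qed.

End Inner.

(** * Algebra of the curvature of a connection form *)

Section Curvature_algebra.
Context {R : comPzRingType} {n : nat}.

(** Commutator of two covariant derivatives of [F]: [a] is the common second derivative, [b] and [c]
    are the first-order terms, which cancel, and the cofactor of [F] that remains is the curvature
    of the connection form. *)
Lemma curv_regroup k (a b c F : 'M[R]_(k, n)) (X Y Z W : 'M[R]_n) :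
  a + (b + F *m X) + (c + F *m Z) - (a + (c + F *m Y) + (b + F *m W)) =
  F *m (X - Y + (Z - W)).
Proof.
by rewrite mulmxDr !mulmxBr; apply/matrixP => i j; rewrite !mxE; ring.
Qed.

(** One entry of that curvature for a pulled-back connection: [p] and [q] are the derivatives of the
    map in the two directions, [s] is its mixed second derivative, whose terms cancel, and [T a b]
    stands for the derivative of the Christoffel symbol [G0 b] along the coordinate [a]. *)
Lemma curv_entry (p q s : 'I_n -> R) (T : 'I_n -> 'I_n -> R)
    (Gd Gc : 'I_n -> 'I_n -> R) (G0 : 'I_n -> R) :
  (\sum_b s b * G0 b + \sum_b \sum_a q b * (p a * T a b))
  - (\sum_b s b * G0 b + \sum_b \sum_a p b * (q a * T a b))
  + (\sum_e (\sum_b q b * Gc e b) * (\sum_a p a * Gd a e)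
     - \sum_e (\sum_b p b * Gc e b) * (\sum_a q a * Gd a e)) =
  \sum_a \sum_b p a * q b *
    (T a b - T b a + \sum_e (Gd a e * Gc e b - Gd b e * Gc e a)).
Proof.
have E1 : \sum_b \sum_a q b * (p a * T a b) = \sum_a \sum_b p a * q b * T a b.
  by rewrite exchange_big; do 2 (apply: eq_bigr => ? _); ring.
have E2 : \sum_b \sum_a p b * (q a * T a b) = \sum_a \sum_b p a * q b * T b a.
  by do 2 (apply: eq_bigr => ? _); ring.
have E3 : \sum_e (\sum_b q b * Gc e b) * (\sum_a p a * Gd a e) =
    \sum_a \sum_b p a * q b * \sum_e Gd a e * Gc e b.
  under eq_bigr do rewrite mulrC big_distrl/=.
  rewrite exchange_big; apply: eq_bigr => a _ /=.
  under eq_bigr do rewrite big_distrr/=.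
  rewrite exchange_big; apply: eq_bigr => b _ /=.
  by rewrite big_distrr; apply: eq_bigr => e _ /=; ring.
have E4 : \sum_e (\sum_b p b * Gc e b) * (\sum_a q a * Gd a e) =
    \sum_a \sum_b p a * q b * \sum_e Gd b e * Gc e a.
  under eq_bigr do rewrite big_distrl/=.
  rewrite exchange_big; apply: eq_bigr => a _ /=.
  under eq_bigr do rewrite big_distrr/=.
  rewrite exchange_big; apply: eq_bigr => b _ /=.
  by rewrite big_distrr; apply: eq_bigr => e _ /=; ring.
have cancel (c a b d : R) : (c + a) - (c + b) + d = a - b + d by ring.
rewrite cancel E1 E2 E3 E4 -!sumrB -big_split.
apply: eq_bigr => a _; rewrite -!sumrB -big_split; apply: eq_bigr => b _ /=.
by rewrite -!mulrBr -mulrDr sumrB.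
Qed.

End Curvature_algebra.

Section Flat_Levi_Civita.
Context {R : realType} {m n : nat}.
Variables (O : set 'rV[R]_m) (Q : set 'rV[R]_n).
Variables (f : 'rV[R]_m -> 'rV[R]_n) (g : 'rV[R]_n -> 'M[R]_n).

Definition gamma (c b d : 'I_n) (y : 'rV[R]_n) : R :=
  2^-1 * \sum_e invmx (g y) c e *
    ('D_(delta_mx 0 b) (fun z => g z e d) y
     + 'D_(delta_mx 0 d) (fun z => g z e b) y
     - 'D_(delta_mx 0 e) (fun z => g z b d) y).

Definition curv_comp (d c a b : 'I_n) (y : 'rV[R]_n) : R :=
  'D_(delta_mx 0 a) (gamma d b c) y - 'D_(delta_mx 0 b) (gamma d a c) y
  + \sum_e (gamma d a e y * gamma e b c y - gamma d b e y * gamma e a c y).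

Definition curv (y p q w : 'rV[R]_n) : 'rV[R]_n :=
  \row_d \sum_a \sum_b \sum_c p 0 a * q 0 b * w 0 c * curv_comp d c a b y.

(** Vectors are rows and act from the left: [V *m christoffel_mx p y] has components Gamma^c_{bd}
    p^b V^d. *)
Definition christoffel_mx (p y : 'rV[R]_n) : 'M[R]_n :=
  \matrix_(d, c) \sum_b p 0 b * gamma c b d y.

Definition conn_form (u x : 'rV[R]_m) : 'M[R]_n :=
  christoffel_mx ('D_u f x) (f x).

(** The direction is a vector and not a field, so the dependence on it is pointwise. Each of the [k]
    rows of [F] is differentiated as a section of the pull-back bundle, so that the product rule
    [nab_mulmx] covers scalar factors and matrix coefficients alike. *)
Definition nab k (u : 'rV[R]_m) (F : 'rV[R]_m -> 'M[R]_(k, n)) (x : 'rV[R]_m)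
    : 'M[R]_(k, n) :=
  'D_u F x + F x *m conn_form u x.

Hypotheses (oO : open O) (oQ : open Q) (sf : smooth_on O f)
  (fOQ : forall x, O x -> Q (f x)) (sg : smooth_on Q g)
  (gT : forall y, Q y -> (g y)^T = g y) (gU : forall y, Q y -> g y \in unitmx).

Let dcoord (k : nat) (F : 'rV[R]_m -> 'M[R]_(k, n)) x i j :
  differentiable F x -> differentiable (fun y => F y i j) x.
Proof. by move=> dF; exact: (differentiable_coordP _ _).1. Qed.

Lemma metric_coord_sym y i j (v : 'rV[R]_n) : Q y ->
  'D_v (fun z => g z i j) y = 'D_v (fun z => g z j i) y.
Proof.
by move=> Qy; apply: (open_eq_derive _ oQ Qy) => z /gT gz; rewrite -{1}gz mxE.
Qed.

Lemma gamma_sym c b d y : Q y -> gamma c b d y = gamma c d b y.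
Proof.
move=> Qy; congr (_ * _); apply: eq_bigr => e _; congr (_ * _).
by rewrite (metric_coord_sym b d)// [X in X - _]addrC.
Qed.

Lemma gamma_lower e b d y : Q y -> \sum_c g y e c * gamma c b d y =
  2^-1 * ('D_(delta_mx 0 b) (fun z => g z e d) y
     + 'D_(delta_mx 0 d) (fun z => g z e b) y
     - 'D_(delta_mx 0 e) (fun z => g z b d) y).
Proof.
move=> Qy.
pose T := \col_e' ('D_(delta_mx 0 b) (fun z => g z e' d) y
     + 'D_(delta_mx 0 d) (fun z => g z e' b) y
     - 'D_(delta_mx 0 e') (fun z => g z b d) y).
have -> : \sum_c g y e c * gamma c b d y = 2^-1 * (g y *m (invmx (g y) *m T)) e 0.
  rewrite mxE big_distrr; apply: eq_bigr => c _ /=.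
  rewrite mulrCA; congr (_ * (_ * _)); rewrite mxE; apply: eq_bigr => e' _.
  by rewrite mxE.
by rewrite mulKVmx ?gU// mxE.
Qed.

Lemma metric_coord_smooth i j : smooth_on Q (fun z => g z i j).
Proof. exact: (smooth_on_coord _ oQ).1. Qed.

Lemma gamma_differentiable c b d y : Q y -> differentiable (gamma c b d) y.
Proof.
move=> Qy; rewrite /gamma.
apply: differentiable_mul; first exact: differentiable_cst.
apply: differentiable_bigsum => e; apply: differentiable_mul.
  apply: (differentiable_coordP _ _).1; apply: (differentiable_invmx oQ Qy gU).
  exact: smooth_on_differentiable Qy.
have dg i j v : differentiable ('D_v (fun z => g z i j)) y.
  apply: smooth_on_differentiable Qy; apply: smooth_on_derive.
  exact: metric_coord_smooth.
apply: differentiable_add; first exact: differentiable_add.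
exact: differentiableN.
Qed.

Lemma christoffel_mx_sym p q y : Q y ->
  q *m christoffel_mx p y = p *m christoffel_mx q y.
Proof.
move=> Qy; apply/rowP => c.
rewrite !mxE; under eq_bigr do rewrite mxE big_distrr/=.
rewrite exchange_big; apply: eq_bigr => b _ /=.
rewrite mxE big_distrr; apply: eq_bigr => d _ /=.
by rewrite gamma_sym//; ring.
Qed.

Lemma christoffel_mxZ c p y :
  christoffel_mx (c *: p) y = c *: christoffel_mx p y.
Proof.
apply/matrixP => i j; rewrite !mxE big_distrr; apply: eq_bigr => b _ /=.
by rewrite mxE mulrA.
Qed.

Lemma christoffel_mx_sum (J : finType) (p : J -> 'rV[R]_n) y :
  christoffel_mx (\sum_a p a) y = \sum_a christoffel_mx (p a) y.
Proof.
apply/matrixP => i j; rewrite mxE summxE.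
under [RHS]eq_bigr do rewrite mxE.
rewrite exchange_big; apply: eq_bigr => b _ /=.
by rewrite summxE big_distrl.
Qed.

Lemma christoffel_mx_lower p y d e : Q y ->
  (christoffel_mx p y *m g y) d e = \sum_b p 0 b *
    (2^-1 * ('D_(delta_mx 0 b) (fun z => g z e d) y
       + 'D_(delta_mx 0 d) (fun z => g z e b) y
       - 'D_(delta_mx 0 e) (fun z => g z b d) y)).
Proof.
move=> Qy; under [RHS]eq_bigr do rewrite -(gamma_lower _ _ _ Qy).
rewrite mxE; under [LHS]eq_bigr do rewrite mxE big_distrl/=.
rewrite exchange_big; apply: eq_bigr => b _ /=.
rewrite big_distrr; apply: eq_bigr => c _ /=.
by rewrite -mulrA [gamma _ _ _ _ * _]mulrC -[in LHS](gT Qy) mxE.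
Qed.

Lemma conn_form_differentiable u x : O x -> differentiable (conn_form u) x.
Proof.
move=> Ox; apply/differentiable_coordP => d c; under eq_fun do rewrite mxE.
apply: differentiable_bigsum => b; apply: differentiable_mul.
  apply: (differentiable_coordP _ _).1.
  by apply: smooth_on_differentiable Ox; exact: smooth_on_derive.
apply: (@differentiable_comp _ _ _ _ f).
  exact: smooth_on_differentiable Ox.
by apply: gamma_differentiable; exact: fOQ.
Qed.

Lemma conn_form_linear u x : O x ->
  conn_form u x = \sum_a u 0 a *: conn_form (delta_mx 0 a) x.
Proof.
move=> Ox; have df : differentiable f x by exact: smooth_on_differentiable Ox.
rewrite /conn_form (derive_row_expand _ df) christoffel_mx_sum.
by apply: eq_bigr => a _; rewrite christoffel_mxZ.
Qed.

(** All rests on the derivative [dgfE] of the metric along [f]: with lowered indices, two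
    Christoffel symbols with outer indices exchanged add up to a plain derivative of the metric. The
    product rule does the rest. *)
Lemma nab_metric u V W x : O x -> differentiable V x -> differentiable W x ->
  'D_u (fun y => inner (g (f y)) (V y) (W y)) x =
  inner (g (f x)) (nab u V x) (W x) + inner (g (f x)) (V x) (nab u W x).
Proof.
move=> Ox dV dW.
have Qfx := fOQ Ox.
have df : differentiable f x by exact: smooth_on_differentiable Ox.
have dg : differentiable g (f x) by exact: smooth_on_differentiable Qfx.
have dgf : differentiable (fun y => g (f y)) x by exact: (differentiable_comp df dg).
have dVg : differentiable (fun y => V y *m g (f y)) x by exact: differentiable_mulmx.
have dWT : differentiable (fun y => (W y)^T) x by exact: differentiable_trmx.
have dgfE : 'D_u (fun y => g (f y)) x =
    conn_form u x *m g (f x) + g (f x) *m (conn_form u x)^T.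
  apply/matrixP => i j; rewrite derive_coord//.
  rewrite (@derive_comp_expand _ _ _ f (fun z => g z i j))//; last first.
    exact: (differentiable_coordP _ _).1.
  have -> : g (f x) *m (conn_form u x)^T = (conn_form u x *m g (f x))^T.
    by rewrite trmx_mul gT.
  rewrite [RHS]mxE [X in _ = _ + X]mxE !christoffel_mx_lower// -big_split; apply: eq_bigr => b _ /=.
  rewrite -mulrDr (metric_coord_sym j i)// (metric_coord_sym b i)//.
  by rewrite (metric_coord_sym b j)//; field.
rewrite /inner -derive_coord; last exact: differentiable_mulmx.
rewrite derive_mulmx// derive_mulmx// derive_trmx// dgfE /nab.
have mxD (A B : 'M[R]_1) : A 0 0 + B 0 0 = (A + B) 0 0 by rewrite mxE.
rewrite mxD; congr (fun_of_matrix _ 0 0).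
rewrite !(linearD, mulmxDl, mulmxDr, trmx_mul, mulmxA)/= -!addrA.
by rewrite trmx_mul mulmxA; congr (_ + (_ + _)); rewrite addrC.
Qed.

(** Second derivatives of [f] commute, and the Christoffel symbols are symmetric in their lower
    indices. *)
Lemma nab_torsion u v x : O x -> nab u ('D_v f) x = nab v ('D_u f) x.
Proof.
move=> Ox; have e1 := derive_sym_mx u v oO sf Ox.
have e2 := christoffel_mx_sym ('D_u f x) ('D_v f x) (fOQ Ox).
exact: (congr2 +%R e1 e2).
Qed.

Lemma nab_mulmx k l u (H : 'rV[R]_m -> 'M[R]_(k, l)) (F : 'rV[R]_m -> 'M[R]_(l, n)) x :
  differentiable H x -> differentiable F x ->
  nab u (fun y => H y *m F y) x = 'D_u H x *m F x + H x *m nab u F x.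
Proof.
by move=> dH dF; rewrite /nab derive_mulmx// mulmxDr !mulmxA addrA.
Qed.

Lemma nab_eq k u (F F' : 'rV[R]_m -> 'M[R]_(k, n)) x : O x ->
  (forall y, O y -> F y = F' y) -> nab u F x = nab u F' x.
Proof.
move=> Ox FF'; have e := open_eq_derive u oO Ox FF'.
exact: (congr2 +%R e (congr1 (mulmx^~ (conn_form u x)) (FF' _ Ox))).
Qed.

Lemma nab_differentiable k u (F : 'rV[R]_m -> 'M[R]_(k, n)) x :
  smooth_on O F -> O x -> differentiable (nab u F) x.
Proof.
move=> sF Ox; apply: differentiable_add.
  by apply: smooth_on_differentiable Ox; exact: smooth_on_derive.
apply: differentiable_mulmx; first exact: smooth_on_differentiable Ox.
exact: conn_form_differentiable.
Qed.

(** Isolates the linear dependence of [nab] on its direction: [nab (Y y) F y] becomes the product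
    [Y y *m grad F y], which can be differentiated even when [Y] varies. *)
Definition grad (F : 'rV[R]_m -> 'rV[R]_n) (x : 'rV[R]_m) : 'M[R]_(m, n) :=
  \matrix_a nab (delta_mx 0 a) F x.

Lemma nab_grad F u x : O x -> differentiable F x -> nab u F x = u *m grad F x.
Proof.
move=> Ox dF; rewrite /nab derive_row_expand// conn_form_linear// mulmx_sumr.
rewrite -big_split mulmx_sum_row; apply: eq_bigr => a _ /=.
by rewrite rowK /nab scalerDr scalemxAr.
Qed.

Lemma grad_differentiable F x : smooth_on O F -> O x -> differentiable (grad F) x.
Proof.
move=> sF Ox; apply/differentiable_coordP => a c; under eq_fun do rewrite mxE.
by apply: (differentiable_coordP _ _).1; exact: nab_differentiable.
Qed.

Lemma nab_field_differentiable (Y : 'rV[R]_m -> 'rV[R]_m)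
    (F : 'rV[R]_m -> 'rV[R]_n) x :
  smooth_on O F -> O x -> differentiable Y x ->
  differentiable (fun y => nab (Y y) F y) x.
Proof.
move=> sF Ox dY; apply: (@open_eq_differentiable _ _ _ O (fun y => Y y *m grad F y)) => //.
  by move=> y Oy; rewrite nab_grad//; exact: smooth_on_differentiable Oy.
by apply: differentiable_mulmx => //; exact: grad_differentiable.
Qed.

Lemma nab_nab_field u (Y : 'rV[R]_m -> 'rV[R]_m)
    (F : 'rV[R]_m -> 'rV[R]_n) x :
  smooth_on O F -> O x -> differentiable Y x ->
  nab u (fun y => nab (Y y) F y) x =
  nab u (nab (Y x) F) x + nab ('D_u Y x) F x.
Proof.
move=> sF Ox dY.
have dF y : O y -> differentiable F y by exact: smooth_on_differentiable.
have dG := grad_differentiable sF Ox.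
have e1 : nab u (fun y => nab (Y y) F y) x =
    'D_u Y x *m grad F x + Y x *m nab u (grad F) x.
  apply: etrans (nab_mulmx u dY dG); apply: nab_eq => // y Oy.
  by apply: nab_grad => //; exact: dF.
have e2 : nab u (nab (Y x) F) x = Y x *m nab u (grad F) x.
  have dc : differentiable (cst (Y x) : 'rV[R]_m -> 'rV[R]_m) x.
    exact: differentiable_cst.
  have := nab_mulmx u dc dG; rewrite derive_cst mul0mx add0r => <-.
  by apply: nab_eq => // y Oy; apply: nab_grad => //; exact: dF.
have e3 := nab_grad ('D_u Y x) Ox (dF _ Ox).
exact: (etrans e1 (etrans (addrC _ _) (congr2 +%R (esym e2) (esym e3)))).
Qed.

(** Constant directions are commuting fields, so no bracket appears: this is the structure equation,
    curvature being the exterior derivative of the connection form plus its commutator, read in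
    coordinates through [f]. *)
Lemma nab_curv_const u v (F : 'rV[R]_m -> 'rV[R]_n) x : smooth_on O F -> O x ->
  nab u (nab v F) x - nab v (nab u F) x = curv (f x) ('D_u f x) ('D_v f x) (F x).
Proof.
move=> sF Ox; have Qfx := fOQ Ox.
have dF : differentiable F x by exact: smooth_on_differentiable Ox.
have df : differentiable f x by exact: smooth_on_differentiable Ox.
have dDf w : differentiable ('D_w f) x.
  by apply: smooth_on_differentiable Ox; exact: smooth_on_derive.
have dDF w : differentiable ('D_w F) x.
  by apply: smooth_on_differentiable Ox; exact: smooth_on_derive.
have dC w : differentiable (conn_form w) x by exact: conn_form_differentiable.
have E w w' : nab w (nab w' F) x = 'D_w ('D_w' F) x + ('D_w F x *m conn_form w' x
    + F x *m 'D_w (conn_form w') x)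
    + ('D_w' F x *m conn_form w x + F x *m (conn_form w' x *m conn_form w x)).
  rewrite {1}/nab derive_add//; last exact: differentiable_mulmx.
  by rewrite derive_mulmx// /nab mulmxDl mulmxA.
have Ev := etrans (E v u) (congr1 (fun a => a + _ + _) (derive_sym_mx v u oO sF Ox)).
apply: etrans (congr2 (fun a b => a - b) (E u v) Ev) _.
apply: etrans (curv_regroup _ _ _ _ _ _ _ _) _.
have Dconn w w' c d : ('D_w (conn_form w') x) c d =
    \sum_b 'D_w ('D_w' f) x 0 b * gamma d b c (f x)
    + \sum_b \sum_a 'D_w' f x 0 b *
        ('D_w f x 0 a * 'D_(delta_mx 0 a) (gamma d b c) (f x)).
  rewrite derive_coord//; under eq_fun do rewrite mxE.
  have dDfb b : differentiable (fun y => 'D_w' f y 0 b) x by exact: dcoord.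
  have dgb b : differentiable (gamma d b c \o f) x.
    by apply: differentiable_comp => //; exact: gamma_differentiable.
  rewrite (@derive_bigsum _ _ _ _ (fun b y => 'D_w' f y 0 b * (gamma d b c \o f) y)).
    rewrite -big_split; apply: eq_bigr => b _.
    rewrite derive_mul// derive_comp_expand//; last exact: gamma_differentiable.
    by rewrite big_distrr; congr (_ * _ + _); rewrite derive_coord.
  by move=> b; exact: differentiable_mul.
have sff := derive_sym_mx u v oO sf Ox.
have key c d : ('D_u (conn_form v) x - 'D_v (conn_form u) x
    + (conn_form v x *m conn_form u x - conn_form u x *m conn_form v x)) c d =
    \sum_a \sum_b 'D_u f x 0 a * 'D_v f x 0 b * curv_comp d c a b (f x).
  have E1 := Dconn u v c d.
  have E2 := etrans (Dconn v u c d) (congr1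
    (fun s : 'rV[R]_n => \sum_b s 0 b * gamma d b c (f x)
       + \sum_b \sum_a 'D_u f x 0 b *
           ('D_v f x 0 a * 'D_(delta_mx 0 a) (gamma d b c) (f x))) (esym sff)).
  have E3 w w' : (conn_form w x *m conn_form w' x) c d =
      \sum_e (\sum_b 'D_w f x 0 b * gamma e b c (f x)) *
              (\sum_a 'D_w' f x 0 a * gamma d a e (f x)).
    rewrite /conn_form; move: ('D_w f x) ('D_w' f x) => p q.
    by rewrite mxE; apply: eq_bigr => e _; rewrite !mxE.
  have mxDB (A B C D : 'M[R]_n) : (A - B + (C - D)) c d = A c d - B c d + (C c d - D c d).
    by rewrite !mxE.
  apply: etrans (mxDB _ _ _ _) _.
  apply: etrans (congr2 +%R (congr2 (fun a b => a - b) E1 E2)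
    (congr2 (fun a b => a - b) (E3 v u) (E3 u v))) _.
  exact: (curv_entry _ _ _ (fun a b => 'D_(delta_mx 0 a) (gamma d b c) (f x))
    (fun a e => gamma d a e (f x)) (fun e b => gamma e b c (f x))).
apply/rowP => d; rewrite mxE [RHS]mxE.
under eq_bigr do rewrite key big_distrr/=.
rewrite exchange_big; apply: eq_bigr => a _ /=.
under eq_bigr do rewrite big_distrr/=.
rewrite exchange_big; apply: eq_bigr => b _ /=.
by apply: eq_bigr => c _; ring.
Qed.

Definition push_field (X : 'rV[R]_m -> 'rV[R]_m) (y : 'rV[R]_m) : 'rV[R]_n :=
  'D_(X y) f y.

Definition bracket (X Y : 'rV[R]_m -> 'rV[R]_m) (x : 'rV[R]_m) : 'rV[R]_m :=
  'D_(X x) Y x - 'D_(Y x) X x.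

Definition partials (y : 'rV[R]_m) : 'M[R]_(m, n) :=
  \matrix_a 'D_(delta_mx 0 a) f y.

Lemma derive_partials u y : O y -> 'D_u f y = u *m partials y.
Proof.
move=> Oy; have df : differentiable f y by exact: smooth_on_differentiable Oy.
apply: etrans (derive_row_expand u df) _; rewrite mulmx_sum_row.
by apply: eq_bigr => a _; rewrite rowK.
Qed.

Lemma partials_coord_smooth a c : smooth_on O (fun y => partials y a c).
Proof.
apply: (@smooth_on_eq _ _ _ _ (fun y => 'D_(delta_mx 0 a) f y 0 c)) => //.
  by move=> y Oy; rewrite mxE.
by apply: (smooth_on_coord _ oO).1; exact: smooth_on_derive.
Qed.

Lemma push_field_smooth X : smooth_on O X -> smooth_on O (push_field X).
Proof.
move=> sX; apply: (@smooth_on_eq _ _ _ _ (fun y => X y *m partials y)) => //.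
  by move=> y Oy; rewrite -derive_partials.
apply/(smooth_on_coord _ oO) => i c; under eq_fun do rewrite mxE.
apply: smooth_on_sum => // a; apply: smooth_onM => //.
  exact: (smooth_on_coord _ oO).1.
exact: partials_coord_smooth.
Qed.

Lemma nab_push u X x : O x -> differentiable X x ->
  nab u (push_field X) x = nab u ('D_(X x) f) x + 'D_('D_u X x) f x.
Proof.
move=> Ox dX.
have dP : differentiable partials x.
  apply/differentiable_coordP => a c.
  exact: smooth_on_differentiable (partials_coord_smooth a c) Ox.
have e1 : nab u (push_field X) x =
    'D_u X x *m partials x + X x *m nab u partials x.
  apply: etrans (nab_mulmx u dX dP); apply: nab_eq => // y Oy.
  exact: derive_partials.
have e2 : nab u ('D_(X x) f) x = X x *m nab u partials x.
  have dc : differentiable (cst (X x) : 'rV[R]_m -> 'rV[R]_m) x.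
    exact: differentiable_cst.
  have := nab_mulmx u dc dP; rewrite derive_cst mul0mx add0r => <-.
  by apply: nab_eq => // y Oy; exact: derive_partials.
have e3 := derive_partials ('D_u X x) Ox.
exact: (etrans e1 (etrans (addrC _ _) (congr2 +%R (esym e2) (esym e3)))).
Qed.

(** For constant directions this is [nab_torsion]; the variation of [X] and [Y] adds the two terms
    whose difference is the bracket. *)
Lemma nab_bracket X Y x : O x -> differentiable X x -> differentiable Y x ->
  nab (X x) (push_field Y) x - nab (Y x) (push_field X) x =
  'D_(bracket X Y x) f x.
Proof.
move=> Ox dX dY.
have e1 := nab_push (X x) Ox dY; have e2 := nab_push (Y x) Ox dX.
have e3 := nab_torsion (X x) (Y x) Ox.
have e4 := etrans e1 (congr1 (fun a => a + _) e3).
apply: etrans (congr2 (fun a b => a - b) e4 e2) _.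
rewrite opprD addrACA subrr add0r.
have eX := derive_partials ('D_(X x) Y x) Ox.
have eY := derive_partials ('D_(Y x) X x) Ox.
apply: etrans (congr2 (fun a b => a - b) eX eY) _.
by rewrite -mulmxBl; exact: esym (derive_partials _ Ox).
Qed.

(** Passing from constant directions to fields adds the derivatives of [F] along ['D_(X x) Y x] and
    ['D_(Y x) X x], with opposite signs; the bracket term removes exactly these. *)
Lemma nab_curv X Y (F : 'rV[R]_m -> 'rV[R]_n) x : smooth_on O F -> O x ->
  differentiable X x -> differentiable Y x ->
  nab (X x) (fun y => nab (Y y) F y) x - nab (Y x) (fun y => nab (X y) F y) x
    - nab (bracket X Y x) F x =
  curv (f x) (push_field X x) (push_field Y x) (F x).
Proof.
move=> sF Ox dX dY.
have dF : differentiable F x by exact: smooth_on_differentiable Ox.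
have e1 := nab_nab_field (X x) sF Ox dY.
have e2 := nab_nab_field (Y x) sF Ox dX.
apply: etrans (nab_curv_const (X x) (Y x) sF Ox).
have e3 : nab (bracket X Y x) F x = nab ('D_(X x) Y x) F x - nab ('D_(Y x) X x) F x.
  rewrite (nab_grad _ Ox dF) mulmxBl.
  exact: (congr2 (fun a b => a - b) (esym (nab_grad _ Ox dF)) (esym (nab_grad _ Ox dF))).
have cancel (a b c d : 'rV[R]_n) : a + b - (c + d) - (b - d) = a - c.
  by apply/rowP => i; rewrite !mxE; ring.
apply: etrans (congr2 (fun a b => a - b) (congr2 (fun a b => a - b) e1 e2) e3) _.
exact: cancel.
Qed.

Lemma nab_linear c u v (F : 'rV[R]_m -> 'rV[R]_n) x : O x -> differentiable F x ->
  nab (c *: u + v) F x = c *: nab u F x + nab v F x.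
Proof.
move=> Ox dF; apply: etrans (nab_grad _ Ox dF) _.
rewrite mulmxDl -scalemxAl.
exact: (congr2 (fun a b => c *: a + b) (esym (nab_grad _ Ox dF)) (esym (nab_grad _ Ox dF))).
Qed.

Lemma nab_scale u (h : 'rV[R]_m -> R) (F : 'rV[R]_m -> 'rV[R]_n) x :
  differentiable h x -> differentiable F x ->
  nab u (fun y => h y *: F y) x = 'D_u h x *: F x + h x *: nab u F x.
Proof.
move=> dh dF.
have dH : differentiable (fun y => (h y)%:M : 'M[R]_1) x.
  apply/differentiable_coordP => i j; under eq_fun do rewrite mxE.
  by rewrite !ord1.
have e := nab_mulmx u dH dF.
have eH : 'D_u (fun y => (h y)%:M : 'M[R]_1) x = ('D_u h x)%:M.
  apply/matrixP => i j; rewrite derive_coord// !ord1 mxE eqxx mulr1n.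
  by congr ('D_u _ x); apply/funext => y; rewrite mxE eqxx mulr1n.
have -> : (fun y => h y *: F y) = (fun y => (h y)%:M *m F y).
  by apply/funext => y; rewrite mul_scalar_mx.
by apply: etrans e _; rewrite eH !mul_scalar_mx.
Qed.

Lemma nab0 u x : nab u (cst (0 : 'rV[R]_n)) x = 0.
Proof. by rewrite /nab derive_cst mul0mx addr0. Qed.

End Flat_Levi_Civita.

(** * Cartan's formula from the Gauss and Codazzi equations *)

Section Cartan_sum.
Context {R : realFieldType} {n : nat}.
Variables (lam : 'I_n -> R) (Gam : 'I_n -> 'I_n -> 'I_n -> R) (kap : 'I_n -> 'I_n -> R).
Hypotheses
  (skew : forall i j l, Gam i j l = - Gam i l j)
  (codazzi : forall i j l,
     (lam j - lam l) * Gam i j l = (lam i - lam l) * Gam j i l)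
  (gauss : forall i j, lam i != lam j ->
     kap i j = \sum_l (Gam i j l * Gam j i l - Gam j j l * Gam i i l
                       - (Gam i j l - Gam j i l) * Gam l j i)).

Let dif a b : lam a != lam b -> lam a - lam b != 0.
Proof. by rewrite subr_eq0. Qed.

Lemma cartan_gam0 i j l : lam i = lam l -> lam j != lam l -> Gam i j l = 0.
Proof.
move=> eil njl; have := codazzi i j l; rewrite eil subrr mul0r => /eqP.
by rewrite mulf_eq0 (negPf (dif njl)) /= => /eqP.
Qed.

Lemma cartan_gam0' i j l : lam i = lam j -> lam l != lam j -> Gam i j l = 0.
Proof. by move=> eij nlj; rewrite skew cartan_gam0 ?oppr0. Qed.

(** Put t_ijl = (lam j - lam l) * Gam i j l, for j <> l the components of the covariant derivative
    of the shape operator. Codazzi exchanges the first two indices and skewness of [Gam] the last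
    two, so t is totally symmetric. The guard keeps the triples with three distinct eigenvalues, the
    only ones that contribute, and is itself symmetric in j and l. *)
Definition cartan_term i j l : R :=
  if [&& lam j != lam i, lam l != lam i & lam j != lam l] then
    2 * ((lam j - lam l) * Gam i j l) ^+ 2
      / ((lam j - lam l) * (lam i - lam l) * (lam i - lam j))
  else 0.

Lemma cartan_term_skew i j l : cartan_term i j l = - cartan_term i l j.
Proof.
rewrite /cartan_term (eq_sym (lam l) (lam j)).
case: (boolP (lam j != lam i)) => /= nji; last by rewrite andbF oppr0.
case: (boolP (lam l != lam i)) => /= nli; last by rewrite oppr0.
case: (boolP (lam j != lam l)) => /= njl; last by rewrite oppr0.
rewrite (skew i j l); have := dif nji; have := dif nli; have := dif njl => a b c.
have d : lam l - lam j != 0 by rewrite -oppr_eq0 opprB.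
have e : lam i - lam j != 0 by rewrite -oppr_eq0 opprB.
have h : lam i - lam l != 0 by rewrite -oppr_eq0 opprB.
by field; rewrite a d e h.
Qed.

(** If [lam l] equals [lam i] or [lam j], every product has a vanishing factor. Otherwise
    [Gam j j l] vanishes and the other coefficients are t_ijl over a difference of eigenvalues. The
    product [Gam i j l * Gam j i l] and the bracket term then contribute equally, whence the factor
    2 of [cartan_term]. *)
Lemma cartan_summand i j l : lam j != lam i ->
  (Gam i j l * Gam j i l - Gam j j l * Gam i i l
     - (Gam i j l - Gam j i l) * Gam l j i) / (lam i - lam j) = cartan_term i j l.
Proof.
move=> nji; rewrite /cartan_term nji /=.
have nij : lam i != lam j by rewrite eq_sym.
have [eli|nli] /= := eqVneq (lam l) (lam i).
  rewrite (cartan_gam0 (esym eli)) ?eli//.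
  rewrite (@cartan_gam0' j j l) ?eli//.
  by rewrite (@cartan_gam0 l j i)// !(mul0r, mulr0, subr0).
have [ejl|njl] /= := eqVneq (lam j) (lam l).
  have nil : lam i != lam l by rewrite -ejl.
  rewrite (cartan_gam0 ejl nil) (cartan_gam0' (erefl (lam i)) nli).
  by rewrite (cartan_gam0' (esym ejl) nij) !(mul0r, mulr0, subr0).
rewrite (@cartan_gam0' j j l)//; last by rewrite eq_sym.
have a := dif nij; have b := dif nji; have c := dif njl; have d := dif nli.
have e : lam i - lam l != 0 by rewrite -oppr_eq0 opprB.
have E1 : Gam j i l = (lam j - lam l) * Gam i j l / (lam i - lam l).
  by rewrite codazzi mulrC mulKf.
have E2 : Gam l j i = (lam j - lam l) * Gam i j l / (lam j - lam i).
  have : (lam j - lam i) * Gam l j i = (lam j - lam l) * Gam i j l.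
    by rewrite (codazzi l j i) (codazzi i j l) (skew j l i); ring.
  by move=> <-; rewrite mulrC mulKf.
rewrite E1 E2; field.
by rewrite a b c e.
Qed.

Theorem cartan_sum i : \sum_(j | lam j != lam i) kap i j / (lam i - lam j) = 0.
Proof.
have -> : \sum_(j | lam j != lam i) kap i j / (lam i - lam j) =
    \sum_j \sum_l cartan_term i j l.
  rewrite big_mkcond; apply: eq_bigr => j _; case: ifPn => [nji|].
    rewrite gauss ?(eq_sym (lam i))// big_distrl; apply: eq_bigr => l _ /=.
    exact: cartan_summand.
  by move=> eji; rewrite big1// => l _; rewrite /cartan_term (negPf eji).
set S := \sum_j _; have : S = - S.
  rewrite [in LHS]/S exchange_big -sumrN; apply: eq_bigr => j _ /=.
  by rewrite -sumrN; apply: eq_bigr => l _; rewrite cartan_term_skew.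
by move=> SN; lra.
Qed.

End Cartan_sum.

(* The Gauss and Codazzi equations are used only through the formal properties
   of the connection [cov] along a map with differential [df]; [dd] is the
   derivative of functions, [br] the bracket of vector fields, [xi], [e i] the
   frame of the source, and [N], [L] its transversal complement. *)
Section Frame_equations.
Context {R : realFieldType} {P : Type} {T W : lmodType R} {n : nat}.
Variables (O : P -> Prop) (ip : P -> W -> W -> R) (df : P -> T -> W)
  (cov : T -> (P -> W) -> P -> W) (dd : T -> (P -> R) -> P -> R)
  (br : (P -> T) -> (P -> T) -> P -> T)
  (smT : (P -> T) -> Prop) (smW dfW : (P -> W) -> Prop) (k : R)
  (xi : P -> T) (e : 'I_n -> P -> T) (N L : P -> W) (lam : 'I_n -> P -> R).

Let F (X : P -> T) (x : P) : W := df x (X x).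

Hypotheses
  (ipDl : forall x a b c, ip x (a + b) c = ip x a c + ip x b c)
  (ipZl : forall x r a c, ip x (r *: a) c = r * ip x a c)
  (ipC : forall x a b, O x -> ip x a b = ip x b a)
  (smW_dfW : forall V, smW V -> dfW V)
  (smF : forall X, smT X -> smW (F X))
  (dfW_cov : forall X V, smT X -> smW V -> dfW (fun y => cov (X y) V y))
  (sm_e : forall i, smT (e i)) (sm_xi : smT xi) (dfN : dfW N) (dfL : dfW L)
  (dd_const : forall u h c x, O x -> (forall y, O y -> h y = c) -> dd u h x = 0)
  (dd_near : forall u h i j x, O x -> lam i x != lam j x ->
     (forall y, O y -> lam i y != lam j y -> h y = 0) -> dd u h x = 0)
  (metric : forall u V V' x, O x -> dfW V -> dfW V' ->
     dd u (fun y => ip y (V y) (V' y)) x =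
     ip x (cov u V x) (V' x) + ip x (V x) (cov u V' x))
  (cov_lin : forall c u v V x, O x -> dfW V ->
     cov (c *: u + v) V x = c *: cov u V x + cov v V x)
  (cov_lam : forall u j V x, O x -> dfW V ->
     cov u (fun y => - lam j y *: V y) x =
     - dd u (lam j) x *: V x + (- lam j x) *: cov u V x)
  (cov_eq : forall u V V' x, O x -> (forall y, O y -> V y = V' y) ->
     cov u V x = cov u V' x)
  (cov0 : forall u x, O x -> cov u (fun => 0) x = 0)
  (torsion : forall X Y x, O x -> smT X -> smT Y ->
     cov (X x) (F Y) x - cov (Y x) (F X) x = df x (br X Y x))
  (curvature : forall X Y V x, O x -> smT X -> smT Y -> smW V ->
     cov (X x) (fun y => cov (Y y) V y) x - cov (Y x) (fun y => cov (X y) V y) x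
       - cov (br X Y x) V x =
     k *: (ip x (F Y x) (V x) *: F X x - ip x (F X x) (V x) *: F Y x))
  (ip_ee : forall i j x, O x -> ip x (F (e i) x) (F (e j) x) = (i == j)%:R)
  (ip_tan_xi : forall u x, O x -> ip x (df x u) (F xi x) = 0)
  (ip_tan_L : forall u x, O x -> ip x (df x u) (L x) = 0)
  (ip_eN : forall i x, O x -> ip x (F (e i) x) (N x) = 0)
  (spanT : forall u x, O x -> u = \sum_l ip x (df x u) (F (e l) x) *: e l x
                                  + ip x (df x u) (N x) *: xi x)
  (complete : forall a b x, O x -> ip x a b =
     \sum_l ip x a (F (e l) x) * ip x b (F (e l) x)
     + (ip x a (F xi x) * ip x b (N x) + ip x a (N x) * ip x b (F xi x))
     + ip x a (L x) * ip x b (L x))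
  (cov_e_xi : forall i x, O x -> cov (e i x) (F xi) x = - lam i x *: F (e i) x)
  (cov_xi_xi : forall x, O x -> cov (xi x) (F xi) x = 0)
  (dd_e_lam : forall i j x, O x -> dd (e i x) (lam j) x = 0).

Let dfF X : smT X -> dfW (F X).
Proof. by move=> /smF /smW_dfW. Qed.

Let ipZr x r a c : O x -> ip x a (r *: c) = r * ip x a c.
Proof. by move=> Ox; rewrite ipC// ipZl ipC. Qed.

Let ip0l x a : ip x 0 a = 0.
Proof. by rewrite -(scale0r 0) ipZl mul0r. Qed.

Let ipNl x a b : ip x (- a) b = - ip x a b.
Proof. by rewrite -scaleN1r ipZl mulN1r. Qed.

Let ip_suml x (J : finType) (V : J -> W) b :
  ip x (\sum_j V j) b = \sum_j ip x (V j) b.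
Proof.
by apply: (big_morph (fun a => ip x a b)) => [a c|]; rewrite ?ipDl ?ip0l.
Qed.

Let cov_dir0 V x : O x -> dfW V -> cov 0 V x = 0.
Proof.
move=> Ox dV; have := cov_lin (-1) 0 0 Ox dV.
by rewrite scaler0 addr0 scaleN1r addNr.
Qed.

Let cov_span u V x : O x -> dfW V -> cov u V x =
  \sum_l ip x (df x u) (F (e l) x) *: cov (e l x) V x
  + ip x (df x u) (N x) *: cov (xi x) V x.
Proof.
move=> Ox dV; have covZ c v : cov (c *: v) V x = c *: cov v V x.
  by rewrite -[c *: v]addr0 cov_lin// cov_dir0// addr0.
have covD v w : cov (v + w) V x = cov v V x + cov w V x.
  by rewrite -[v]scale1r cov_lin// !scale1r.
rewrite {1}(spanT u Ox) covD covZ; congr (_ + _).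
rewrite (big_morph (fun v => cov v V x) (id1 := 0) (op1 := +%R)) //.
  by apply: eq_bigr => l _; rewrite covZ.
exact: cov_dir0.
Qed.

Let cov_xi u x : O x ->
  cov u (F xi) x = - \sum_l (ip x (df x u) (F (e l) x) * lam l x) *: F (e l) x.
Proof.
move=> Ox; rewrite cov_span//; last exact: dfF.
rewrite cov_xi_xi// scaler0 addr0 -sumrN; apply: eq_bigr => l _.
by rewrite cov_e_xi// scalerA mulrN scaleNr.
Qed.

(** The coefficient G_ij^l of the induced connection can be computed with the ambient one, since the
    transversal part of the derivative is orthogonal to E_l. *)
Definition connection_coef (x : P) (i j l : 'I_n) : R :=
  ip x (cov (e i x) (F (e j)) x) (F (e l) x).
Local Notation Gam := connection_coef.

Lemma connection_coef_skew x i j l : O x -> Gam x i j l = - Gam x i l j.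
Proof.
move=> Ox; have := metric (e i x) Ox (dfF (sm_e j)) (dfF (sm_e l)).
rewrite (dd_const _ Ox (fun y Oy => ip_ee j l Oy)) (ipC (F (e j) x))//.
by rewrite /Gam => /esym/eqP; rewrite addr_eq0 => /eqP.
Qed.

Let ip_sum_e x (c : 'I_n -> R) i : O x ->
  ip x (\sum_l c l *: F (e l) x) (F (e i) x) = c i.
Proof.
move=> Ox; rewrite ip_suml (bigD1 i)//= ipZl ip_ee// eqxx mulr1 big1 ?addr0//.
by move=> l nli; rewrite ipZl ip_ee// (negPf nli) mulr0.
Qed.

Let br_coef x X Y i : O x -> smT X -> smT Y ->
  ip x (df x (br X Y x)) (F (e i) x) =
  ip x (cov (X x) (F Y) x) (F (e i) x) - ip x (cov (Y x) (F X) x) (F (e i) x).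
Proof. by move=> Ox sX sY; rewrite -torsion// ipDl ipNl. Qed.

(** The E_l-component of R(E_i, E_j) xi, which is zero because xi is orthogonal to all tangent
    vectors; the bracket term supplies the multiples of [lam l]. *)
Lemma frame_codazzi x i j l : O x ->
  (lam j x - lam l x) * Gam x i j l = (lam i x - lam l x) * Gam x j i l.
Proof.
move=> Ox; have := curvature Ox (sm_e i) (sm_e j) (smF sm_xi).
rewrite !ip_tan_xi// !scale0r subr0 scaler0.
rewrite (cov_eq (e i x) Ox (fun y Oy => cov_e_xi j Oy)).
rewrite (cov_eq (e j x) Ox (fun y Oy => cov_e_xi i Oy)).
rewrite !cov_lam//; try exact: dfF.
rewrite !dd_e_lam// !oppr0 !scale0r !add0r cov_xi//.
move/(congr1 (fun v => ip x v (F (e l) x))).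
rewrite ip0l !ipDl !ipNl !ipZl ip_sum_e// br_coef// -!/(Gam x _ _ _).
by move=> H; lra.
Qed.

(** The E_i-component of R(xi, E_j) xi = 0 reduces to (lam i - lam j) times this coefficient: the
    derivative of [lam j] along xi comes with E_j, which is orthogonal to E_i. *)
Lemma cov_xi_coef x i j : O x -> lam i x != lam j x ->
  ip x (cov (xi x) (F (e j)) x) (F (e i) x) = 0.
Proof.
move=> Ox nij; have := curvature Ox sm_xi (sm_e j) (smF sm_xi).
rewrite !ip_tan_xi// !scale0r subr0 scaler0.
rewrite (cov_eq (xi x) Ox (fun y Oy => cov_e_xi j Oy)).
rewrite (cov_eq (e j x) Ox (fun y Oy => cov_xi_xi Oy)).
rewrite cov0// subr0 cov_lam//; last exact: dfF.
rewrite cov_xi// => /(congr1 (fun v => ip x v (F (e i) x))).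
have nji : j == i = false by apply: contraNF nij => /eqP ->.
rewrite ip0l !ipDl !ipNl !ipZl ip_sum_e// br_coef// cov_e_xi// ipZl.
rewrite !ip_ee// nji !mulr0 subr0 opprK.
set c := ip x _ _ => H; have : (lam i x - lam j x) * c = 0 by lra.
by move/eqP; rewrite mulf_eq0 subr_eq0 (negPf nij) => /eqP.
Qed.

(** Pairing with [xi] reads off the coefficient of [N], so this is B(E_i, E_j); the pairings with
    [N] and [L] below are C(E_i, E_j) and D(E_i, E_j), expressed by the derivatives of [N] and
    [L]. *)
Lemma cov_e_ip_xi x i j : O x ->
  ip x (cov (e i x) (F (e j)) x) (F xi x) = (i == j)%:R * lam i x.
Proof.
move=> Ox; have := metric (e i x) Ox (dfF (sm_e j)) (dfF sm_xi).
rewrite (dd_const _ Ox (fun y Oy => ip_tan_xi (e j y) Oy)) cov_e_xi// ipZr//.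
by rewrite ip_ee// (eq_sym j) => H; lra.
Qed.

Lemma cov_e_ip_N x i j : O x ->
  ip x (cov (e i x) (F (e j)) x) (N x) = - ip x (cov (e i x) N x) (F (e j) x).
Proof.
move=> Ox; have := metric (e i x) Ox (dfF (sm_e j)) dfN.
by rewrite (dd_const _ Ox (fun y Oy => ip_eN j Oy)) (ipC (F (e j) x))// => H; lra.
Qed.

Lemma cov_e_ip_L x i j : O x ->
  ip x (cov (e i x) (F (e j)) x) (L x) = - ip x (cov (e i x) L x) (F (e j) x).
Proof.
move=> Ox; have := metric (e i x) Ox (dfF (sm_e j)) dfL.
rewrite (dd_const _ Ox (fun y Oy => ip_tan_L (e j y) Oy)) (ipC (F (e j) x))//.
by move=> H; lra.
Qed.

(** The symmetry of D on the screen: the bracket is tangent, hence orthogonal to [L]. *)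
Lemma cov_L_sym x i j : O x ->
  ip x (cov (e i x) L x) (F (e j) x) = ip x (cov (e j x) L x) (F (e i) x).
Proof.
move=> Ox; have := torsion Ox (sm_e i) (sm_e j).
move/(congr1 (fun v => ip x v (L x))).
by rewrite ip_tan_L// ipDl ipNl !cov_e_ip_L// => H; lra.
Qed.

(** The E_i-component of R(E_i, E_j) E_j, equal to k. Metric compatibility trades second derivatives
    for products of first ones, which [complete] expands: the pair [xi], [N] yields the terms in the
    derivative of [N], and [L] those in the derivative of [L]. *)
Lemma frame_gauss x i j : O x -> lam i x != lam j x ->
  k - lam j x * ip x (cov (e i x) N x) (F (e i) x)
    - lam i x * ip x (cov (e j x) N x) (F (e j) x)
    + ip x (cov (e j x) L x) (F (e j) x) * ip x (cov (e i x) L x) (F (e i) x)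
    - ip x (cov (e i x) L x) (F (e j) x) ^+ 2 =
  \sum_l (Gam x i j l * Gam x j i l - Gam x j j l * Gam x i i l
          - (Gam x i j l - Gam x j i l) * Gam x l j i).
Proof.
move=> Ox nij.
(* Both coefficients vanish wherever the two eigenvalues differ and not only at [x], which is what
   allows [dd_near] to remove their derivatives. *)
have G0 y : O y -> lam i y != lam j y -> Gam y i j i = 0 /\ Gam y j j i = 0.
  move=> Oy nijy; split.
    have /eqP := frame_codazzi i j i Oy.
    by rewrite subrr mul0r mulf_eq0 subr_eq0 eq_sym (negPf nijy) => /eqP.
  rewrite connection_coef_skew//; have /eqP := frame_codazzi j i j Oy.
  by rewrite subrr mul0r mulf_eq0 subr_eq0 (negPf nijy) => /eqP ->; rewrite oppr0.
have dC a b := dfW_cov (sm_e a) (smF (sm_e b)).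
have e1 := metric (e i x) Ox (dC j j) (dfF (sm_e i)).
rewrite (dd_near _ Ox nij) in e1; last by move=> y Oy nijy; have [_] := G0 y Oy nijy.
have e2 := metric (e j x) Ox (dC i j) (dfF (sm_e i)).
rewrite (dd_near _ Ox nij) in e2; last by move=> y Oy nijy; have [] := G0 y Oy nijy.
have := curvature Ox (sm_e i) (sm_e j) (smF (sm_e j)).
move/(congr1 (fun v => ip x v (F (e i) x))).
have nijE : i == j = false by apply: contraNF nij => /eqP ->.
rewrite ipZl 2!ipDl !ipNl !ip_ee// eqxx nijE scale1r scale0r subr0 ip_ee// eqxx mulr1.
(* The bracket is expanded in the frame; its component along [xi] contributes nothing by
   [cov_xi_coef]. *)
have -> : ip x (cov (br (e i) (e j) x) (F (e j)) x) (F (e i) x) =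
    \sum_l (Gam x i j l - Gam x j i l) * Gam x l j i.
  rewrite cov_span//; last exact: dfF.
  rewrite ipDl ip_suml ipZl cov_xi_coef// mulr0 addr0.
  by apply: eq_bigr => l _; rewrite ipZl br_coef.
have := complete (cov (e j x) (F (e j)) x) (cov (e i x) (F (e i)) x) Ox.
have := complete (cov (e i x) (F (e j)) x) (cov (e j x) (F (e i)) x) Ox.
rewrite !cov_e_ip_xi// !cov_e_ip_N// !cov_e_ip_L// (cov_L_sym j i)//.
rewrite !eqxx nijE (eq_sym j) nijE !sumrB mulr1n mulr0n /connection_coef => E1 E2 E3.
lra.
Qed.

Theorem frame_cartan x i : O x ->
  \sum_(j | lam j x != lam i x)
    (k - lam j x * ip x (cov (e i x) N x) (F (e i) x)
       - lam i x * ip x (cov (e j x) N x) (F (e j) x)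
       + ip x (cov (e j x) L x) (F (e j) x) * ip x (cov (e i x) L x) (F (e i) x)
       - ip x (cov (e i x) L x) (F (e j) x) ^+ 2)
    / (lam i x - lam j x) = 0.
Proof.
move=> Ox.
exact: (cartan_sum (fun i j l => connection_coef_skew i j l Ox)
  (fun i j l => frame_codazzi i j l Ox) (fun i j => @frame_gauss x i j Ox)).
Qed.

End Frame_equations.

(** * Cartan's formula in coordinates *)

Section Dual_bases.
Context {R : comUnitRingType}.

(** The pairing hypothesis says that two square matrices have product 1 in one order; they then have
    product 1 in the other order, which is the expansion of [u]. *)
Lemma span_of_dual r s (J : 'M[R]_(r, s)) (A : 'M[R]_s)
    (E : 'I_r -> 'rV[R]_r) (V : 'I_r -> 'rV[R]_s) :
  (forall a b, (E a *m J *m A *m (V b)^T) 0 0 = (a == b)%:R) ->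
  forall u, u = \sum_a (u *m J *m A *m (V a)^T) 0 0 *: E a.
Proof.
move=> dual u.
pose B := J *m A *m (\matrix_a V a)^T.
have BE v b : (v *m B) 0 b = (v *m J *m A *m (V b)^T) 0 0.
  rewrite !mulmxA !mxE; apply: eq_bigr => c _; by rewrite !mxE.
have EB : (\matrix_a E a) *m B = 1%:M.
  apply/row_matrixP => a; rewrite row_mul rowK; apply/rowP => b.
  by rewrite BE dual !mxE.
rewrite -[LHS]mulmx1 -(mulmx1C EB) mulmxA mulmx_sum_row.
by apply: eq_bigr => a _; rewrite BE rowK.
Qed.

End Dual_bases.

Section Gram_expansion.
Context {R : realType} {s : nat} (A : 'M[R]_s).

(** The Gram matrix is the permutation matrix of an involution, so [V (sigma a)] is dual to [V a]:
    unit vectors are fixed by [sigma], and the two members of a null pair are exchanged. *)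
Lemma gram_expansion (V : 'I_s -> 'rV[R]_s) (sigma : 'I_s -> 'I_s) :
  A^T = A -> involutive sigma ->
  (forall a b, inner A (V a) (V b) = (sigma a == b)%:R) ->
  forall u v, inner A u v = \sum_a inner A u (V a) * inner A v (V (sigma a)).
Proof.
move=> sA ss gram u v.
have uE : u = \sum_a inner A u (V a) *: V (sigma a).
  have dual a b : (V (sigma a) *m 1%:M *m A *m (V b)^T) 0 0 = (a == b)%:R.
    by rewrite mulmx1; have := gram (sigma a) b; rewrite ss.
  by rewrite {1}(span_of_dual dual u) mulmx1.
rewrite {1}uE inner_suml; apply: eq_bigr => a _.
by rewrite innerZl (inner_sym v).
Qed.

End Gram_expansion.

Definition ord_cons {T : Type} {n : nat} (t : T) (h : 'I_n -> T) (a : 'I_n.+1) : T :=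
  oapp h t (unlift ord0 a).

Lemma ord_cons0 (T : Type) n (t : T) (h : 'I_n -> T) : ord_cons t h ord0 = t.
Proof. by rewrite /ord_cons unlift_none. Qed.

Lemma ord_consS (T : Type) n (t : T) (h : 'I_n -> T) i :
  ord_cons t h (lift ord0 i) = h i.
Proof. by rewrite /ord_cons liftK. Qed.

(** * Expansion of the metric in a quasi-orthonormal frame *)

Section Quasi_orthonormal_frame.
Context {R : realType} {n : nat} (A : 'M[R]_n.+3).
Variables (F : 'I_n -> 'rV[R]_n.+3) (X N L : 'rV[R]_n.+3).
Hypotheses (sA : A^T = A)
  (FF : forall i j, inner A (F i) (F j) = (i == j)%:R)
  (FX : forall i, inner A (F i) X = 0) (FN : forall i, inner A (F i) N = 0)
  (FL : forall i, inner A (F i) L = 0)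
  (XX : inner A X X = 0) (XN : inner A X N = 1) (XL : inner A X L = 0)
  (NN : inner A N N = 0) (NL : inner A N L = 0) (LL : inner A L L = 1).

Lemma frame_expansion u v : inner A u v =
  \sum_l inner A u (F l) * inner A v (F l)
  + (inner A u X * inner A v N + inner A u N * inner A v X)
  + inner A u L * inner A v L.
Proof.
(* The indices 0, 1, 2 carry [X], [N], [L]; [sg] exchanges the first two, which form the null pair,
   and fixes all others. *)
pose V := ord_cons X (ord_cons N (ord_cons L F)).
pose sg : 'I_n.+3 -> 'I_n.+3 := ord_cons (lift ord0 ord0)
  (ord_cons ord0 (fun b => lift ord0 (lift ord0 b))).
have sgK : involutive sg.
  move=> a; rewrite /sg; case: (unliftP ord0 a) => [b ->|->].
    by case: (unliftP ord0 b) => [c ->|->]; rewrite !(ord_consS, ord_cons0).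
  by rewrite !(ord_consS, ord_cons0).
have l0 k (b : 'I_k) : (lift ord0 b == ord0) = false by [].
have l0' k (b : 'I_k) : (ord0 == lift ord0 b) = false by [].
have ll k (b c : 'I_k) : (lift ord0 b == lift ord0 c) = (b == c).
  by apply: inj_eq; exact: lift_inj.
have C a b := inner_sym a b sA.
have gram a b : inner A (V a) (V b) = (sg a == b)%:R.
  rewrite /V /sg; case: (unliftP ord0 a) => [{}a ->|->]; last first.
    rewrite !ord_cons0; case: (unliftP ord0 b) => [{}b ->|->].
      case: (unliftP ord0 b) => [{}b ->|->].
        case: (unliftP ord0 b) => [{}b ->|->].
          by rewrite !ord_consS C FX.
        by rewrite !(ord_consS, ord_cons0) XL.
      by rewrite !(ord_consS, ord_cons0) XN.
    by rewrite !(ord_consS, ord_cons0) XX.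
  case: (unliftP ord0 a) => [{}a ->|->]; last first.
    case: (unliftP ord0 b) => [{}b ->|->].
      case: (unliftP ord0 b) => [{}b ->|->].
        case: (unliftP ord0 b) => [{}b ->|->].
          by rewrite !(ord_consS, ord_cons0) C FN.
        by rewrite !(ord_consS, ord_cons0) NL.
      by rewrite !(ord_consS, ord_cons0) NN.
    by rewrite !(ord_consS, ord_cons0) C XN.
  case: (unliftP ord0 b) => [{}b ->|->]; last first.
    case: (unliftP ord0 a) => [{}a ->|->].
      by rewrite !(ord_consS, ord_cons0) FX.
    by rewrite !(ord_consS, ord_cons0) C XL.
  case: (unliftP ord0 b) => [{}b ->|->]; last first.
    case: (unliftP ord0 a) => [{}a ->|->].
      by rewrite !(ord_consS, ord_cons0) FN ll l0.
    by rewrite !(ord_consS, ord_cons0) C NL ll.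
  case: (unliftP ord0 a) => [{}a ->|->]; case: (unliftP ord0 b) => [{}b ->|->].
  - by rewrite !ord_consS FF !ll.
  - by rewrite !(ord_consS, ord_cons0) FL !ll.
  - by rewrite !(ord_consS, ord_cons0) C FL !ll.
  - by rewrite !(ord_consS, ord_cons0) LL !ll.
rewrite (gram_expansion sA sgK gram) !big_ord_recl /sg /V.
rewrite !(ord_consS, ord_cons0).
under eq_bigr do rewrite !ord_consS.
by ring.
Qed.

End Quasi_orthonormal_frame.

(** * Cartan's formula for a map between open sets *)

Section Flat_Cartan.
Context {R : realType} {m : nat}.
Variables (O : set 'rV[R]_m.+1) (Q : set 'rV[R]_m.+3).
Variables (f : 'rV[R]_m.+1 -> 'rV[R]_m.+3) (g : 'rV[R]_m.+3 -> 'M[R]_m.+3) (k : R).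
Variables (xi : 'rV[R]_m.+1 -> 'rV[R]_m.+1) (e : 'I_m -> 'rV[R]_m.+1 -> 'rV[R]_m.+1)
  (N L : 'rV[R]_m.+1 -> 'rV[R]_m.+3) (lam : 'I_m -> 'rV[R]_m.+1 -> R).
Local Notation ip x := (inner (g (f x))).
Local Notation F := (push_field f).
Hypotheses (oO : open O) (oQ : open Q) (sf : smooth_on O f)
  (fOQ : forall x, O x -> Q (f x)) (sg : smooth_on Q g)
  (gT : forall y, Q y -> (g y)^T = g y) (gU : forall y, Q y -> g y \in unitmx)
  (Kg : forall y p q w, Q y ->
     curv g y p q w = k *: (inner (g y) q w *: p - inner (g y) p w *: q))
  (sxi : smooth_on O xi) (se : forall i, smooth_on O (e i))
  (sN : smooth_on O N) (sL : smooth_on O L) (slam : forall i, smooth_on O (lam i))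
  (ip_ee : forall i j x, O x -> ip x (F (e i) x) (F (e j) x) = (i == j)%:R)
  (ip_tan_xi : forall u x, O x -> ip x ('D_u f x) (F xi x) = 0)
  (ip_tan_L : forall u x, O x -> ip x ('D_u f x) (L x) = 0)
  (ip_eN : forall i x, O x -> ip x (F (e i) x) (N x) = 0)
  (ip_xiN : forall x, O x -> ip x (F xi x) (N x) = 1)
  (ip_NN : forall x, O x -> ip x (N x) (N x) = 0)
  (ip_NL : forall x, O x -> ip x (N x) (L x) = 0)
  (ip_LL : forall x, O x -> ip x (L x) (L x) = 1)
  (nab_e_xi : forall i x, O x ->
     nab f g (e i x) (F xi) x = - lam i x *: F (e i) x)
  (nab_xi_xi : forall x, O x -> nab f g (xi x) (F xi) x = 0)
  (derive_e_lam : forall i j x, O x -> 'D_(e i x) (lam j) x = 0).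

(** By continuity the two eigenvalues still differ on a neighbourhood of [x], where [h] is therefore
    zero. *)
Let near_zero u (h : 'rV[R]_m.+1 -> R) i j x : O x -> lam i x != lam j x ->
  (forall y, O y -> lam i y != lam j y -> h y = 0) -> 'D_u h x = 0.
Proof.
move=> Ox nij h0.
have cl l : {for x, continuous (lam l)}.
  by apply: differentiable_continuous; exact: smooth_on_differentiable (slam l) Ox.
have nn : \forall y \near x, lam i y - lam j y != 0.
  have c : (fun y => lam i y - lam j y) @ x --> lam i x - lam j x.
    exact: (cvgB (cl i) (cl j)).
  have n0 : lam i x - lam j x != 0 by rewrite subr_eq0.
  exact: cvgr_neq0 _ c n0.
have nO : \forall y \near x, O y by exact: open_nbhs_nbhs.
have hE : \forall y \near x, h y = cst 0 y.
  by move: nn nO; apply: filterS2 => y; rewrite subr_eq0 => nijy Oy; exact: h0.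
by apply: etrans (near_eq_derive u hE) _; exact: derive_cst.
Qed.

Let expand a b x : O x -> ip x a b =
  \sum_l ip x a (F (e l) x) * ip x b (F (e l) x)
  + (ip x a (F xi x) * ip x b (N x) + ip x a (N x) * ip x b (F xi x))
  + ip x a (L x) * ip x b (L x).
Proof.
move=> Ox; apply: frame_expansion.
- by apply: gT; exact: fOQ.
- by move=> i j; exact: ip_ee.
- by move=> i; exact: ip_tan_xi.
- by move=> i; exact: ip_eN.
- by move=> i; exact: ip_tan_L.
- exact: ip_tan_xi.
- exact: ip_xiN.
- exact: ip_tan_L.
- exact: ip_NN.
- exact: ip_NL.
- exact: ip_LL.
Qed.

(** The m + 1 vectors [xi], [e l] of the source are dual, for the ambient metric, to [N] and the
    images of the [e l]; the dimension of the source is m + 1, so [span_of_dual] applies. *)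
Let span_tangent u x : O x -> u =
  \sum_l ip x ('D_u f x) (F (e l) x) *: e l x + ip x ('D_u f x) (N x) *: xi x.
Proof.
move=> Ox; have DJ v := derive_partials sf v Ox.
pose E := ord_cons (xi x) (fun l => e l x).
pose V := ord_cons (N x) (fun l => F (e l) x).
have dual a b : inner (g (f x)) (E a *m partials f x) (V b) = (a == b)%:R.
  rewrite -DJ /E /V.
  case: (unliftP ord0 a) => [{}a ->|->]; case: (unliftP ord0 b) => [{}b ->|->];
    rewrite !(ord_consS, ord_cons0).
  - by rewrite ip_ee// (inj_eq lift_inj).
  - exact: ip_eN.
  - rewrite inner_sym; last by apply: gT; exact: fOQ.
    exact: ip_tan_xi.
  - by rewrite ip_xiN.
have := span_of_dual dual u; rewrite big_ord_recl /E /V !ord_cons0.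
rewrite -(DJ u) addrC => {1}->; congr (_ + _).
by apply: eq_bigr => l _; rewrite !ord_consS.
Qed.

Theorem flat_cartan x i : O x ->
  \sum_(j | lam j x != lam i x)
    (k - lam j x * ip x (nab f g (e i x) N x) (F (e i) x)
       - lam i x * ip x (nab f g (e j x) N x) (F (e j) x)
       + ip x (nab f g (e j x) L x) (F (e j) x) * ip x (nab f g (e i x) L x) (F (e i) x)
       - ip x (nab f g (e i x) L x) (F (e j) x) ^+ 2)
    / (lam i x - lam j x) = 0.
Proof.
have dX (X : 'rV[R]_m.+1 -> 'rV[R]_m.+1) y : smooth_on O X -> O y ->
  differentiable X y by exact: smooth_on_differentiable.
move=> Ox.
apply: (@frame_cartan R _ 'rV[R]_m.+1 'rV[R]_m.+3 m O (fun y a b => ip y a b)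
  (fun y u => 'D_u f y) (@nab _ _ _ f g 1) (fun u h y => 'D_u h y) bracket
  (smooth_on O) (smooth_on O) (fun V => forall y, O y -> differentiable V y)
  k xi e N L lam _ _ _ _ _ _ _ _ _ _ _ _ _ _
   _ _ _ _ _ _ _ _ _ _ _ _ _ _ x i Ox).
- by move=> *; exact: innerDl.
- by move=> *; exact: innerZl.
- by move=> y a b Oy; apply: inner_sym; apply: gT; exact: fOQ.
- by move=> V sV y Oy; exact: smooth_on_differentiable Oy.
- by move=> X; exact: push_field_smooth.
- move=> X V sX sV y Oy.
  by apply: (nab_field_differentiable oO oQ sf fOQ sg gU sV Oy); exact: dX.
- exact: se.
- exact: sxi.
- by move=> y; exact: smooth_on_differentiable.
- by move=> y; exact: smooth_on_differentiable.
- move=> u h c y Oy hc; have := open_eq_derive u oO Oy hc.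
  by move=> ->; exact: derive_cst.
- exact: near_zero.
- move=> u V V' y Oy dV dV'.
  by apply: (nab_metric oQ sf fOQ sg gT gU) => //; [exact: dV|exact: dV'].
- by move=> c u v V y Oy dV; exact: (nab_linear g sf c u v Oy (dV y Oy)).
- move=> u j V y Oy dV.
  have dl : differentiable (lam j) y by exact: smooth_on_differentiable (slam j) Oy.
  have dlN : differentiable (fun z => - lam j z) y by exact: differentiableN.
  apply: etrans (nab_scale _ _ _ dlN (dV y Oy)) _.
  have dlu : derivable (lam j) y u by exact: diff_derivable.
  exact: (congr1 (fun r => r *: V y + _) (deriveN dlu)).
- by move=> u V V' y Oy VV'; exact: (nab_eq f g oO u Oy VV').
- by move=> u y Oy; exact: nab0.
- by move=> X Y y Oy sX sY; apply: (nab_bracket oO oQ sf fOQ gT) => //; exact: dX.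
- move=> X Y V y Oy sX sY sV.
  have := nab_curv oO oQ sf fOQ sg gU sV Oy (dX _ _ sX Oy) (dX _ _ sY Oy).
  by move=> ->; apply: Kg; exact: fOQ.
- exact: ip_ee.
- exact: ip_tan_xi.
- exact: ip_tan_L.
- exact: ip_eN.
- exact: span_tangent.
- exact: expand.
- exact: nab_e_xi.
- exact: nab_xi_xi.
- exact: derive_e_lam.
Qed.

End Flat_Cartan.

(** * Geometry of M in charts *)

Section Jacobian.
Context {R : realType}.

Lemma derive_comp (U V W : normedModType R) (f : U -> V) (h : V -> W) x u :
  differentiable f x -> differentiable h (f x) ->
  'D_u (h \o f) x = 'D_('D_u f x) h (f x).
Proof.
move=> df dh; have dhf : differentiable (h \o f) x by exact: differentiable_comp.
apply: etrans (deriveE u dhf) _; rewrite diff_comp// /=.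
by rewrite -(deriveE u df) -(deriveE _ dh).
Qed.

Lemma jacobian_derive r s (A B : 'M[R]_(r, s)) :
  (forall u : 'rV[R]_r, u *m A = u *m B) -> A = B.
Proof. by move=> AB; apply/row_matrixP => i; rewrite !rowE. Qed.

Lemma jacobian_comp r s t (f : 'rV[R]_r -> 'rV[R]_s) (h : 'rV[R]_s -> 'rV[R]_t) x :
  differentiable f x -> differentiable h (f x) ->
  jacobian (h \o f) x = jacobian f x *m jacobian h (f x).
Proof.
move=> df dh; have dhf : differentiable (h \o f) x by exact: differentiable_comp.
apply: jacobian_derive => u; rewrite mulmxA -(deriveEjacobian u dhf).
by rewrite -(deriveEjacobian u df) -(deriveEjacobian _ dh); exact: derive_comp.
Qed.

Lemma open_eq_jacobian r s (O : set 'rV[R]_r) (f h : 'rV[R]_r -> 'rV[R]_s) x :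
  open O -> O x -> (forall y, O y -> f y = h y) -> differentiable f x ->
  jacobian f x = jacobian h x.
Proof.
move=> oO Ox fh df; have dh := open_eq_differentiable oO Ox fh df.
apply: jacobian_derive => u; apply: etrans (esym (deriveEjacobian u df)) _.
exact: etrans (open_eq_derive u oO Ox fh) (deriveEjacobian u dh).
Qed.

Lemma jacobian_id r (x : 'rV[R]_r) : jacobian id x = 1%:M.
Proof.
apply: jacobian_derive => u; rewrite mulmx1 -deriveEjacobian//.
exact: derive_id.
Qed.

End Jacobian.

(** * Change of charts *)

Section Charts.
Context {R : realType} {n : nat} (M : manifold R n).
Implicit Types (a b : chart M) (p q : M).

Lemma chart_image_open a (W : set M) : open W -> open (coord a @` (dom a `&` W)).
Proof.
move=> oW; have oD := @image_open R n M a.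
have cp : {in coord a @` dom a, continuous (@param R n M a)}.
  by rewrite -continuous_open_subspace//; exact: param_continuous.
have := (continuous_inP (@param R n M a) oD).1 cp W oW.
rewrite (_ : _ `&` _ = coord a @` (dom a `&` W)) //.
apply/seteqP; split => [x [[q aq <-]]|x [q [aq Wq] <-]].
  by rewrite /preimage /= coordK// => Wq; exists q.
by split; [exists q|rewrite /preimage /= coordK].
Qed.

Lemma transition_differentiable a b q : dom a q -> dom b q ->
  differentiable (coord b \o param a) (coord a q).
Proof.
move=> aq bq; apply: (smooth_on_differentiable (@transition_smooth R n M a b)).
by exists q.
Qed.

(** Chain rule for the two transition maps between [a] and the preferred chart [c]: their composite
    is the identity on the overlap, an open set of coordinates. *)
Lemma chart_comp_frame a q : dom a q -> chart_comp a q *m chart_frame a q = 1%:M.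
Proof.
move=> aq; rewrite /chart_comp /chart_frame; set c := chart_at q.
have cq : dom c q := mem_chart_at q.
have e : coord a q = (coord a \o param c) (coord c q) by rewrite /= coordK.
have d1 := transition_differentiable cq aq.
have d2 := transition_differentiable aq cq.
rewrite e in d2 *; rewrite -jacobian_comp// -(jacobian_id (coord c q)).
apply: (@open_eq_jacobian _ _ _ (coord c @` (dom c `&` dom a))).
- by apply: chart_image_open; exact: dom_open.
- by exists q.
- by move=> y [z [cz az] <-]; rewrite /= (coordK cz) (coordK az).
- exact: (differentiable_comp d1 d2).
Qed.

Lemma chart_frame_comp a q : dom a q -> chart_frame a q *m chart_comp a q = 1%:M.
Proof. by move/chart_comp_frame/mulmx1C. Qed.

(** [tderive] differentiates in the preferred chart of the base point, which may change from point
    to point; this moves the derivative to a fixed chart. *)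
Lemma tderive_chart (W : normedModType R) a q v (F : M -> W) : dom a q ->
  differentiable (F \o param a) (coord a q) ->
  tderive q v F = 'D_(v *m chart_comp a q) (F \o param a) (coord a q).
Proof.
move=> aq dF; rewrite /tderive /chart_comp; set c := chart_at q.
have cq : dom c q := mem_chart_at q.
have d1 := transition_differentiable cq aq.
have e : coord a q = (coord a \o param c) (coord c q) by rewrite /= coordK.
rewrite -(deriveEjacobian v d1) e; rewrite e in dF.
apply: etrans (derive_comp v d1 dF).
apply: (@open_eq_derive _ _ _ (coord c @` (dom c `&` dom a))).
- by apply: chart_image_open; exact: dom_open.
- by exists q.
- by move=> y [z [cz az] <-]; rewrite /= (coordK cz) (coordK az).
Qed.

End Charts.

Section Push_forward.
Context {R : realType} {n n' : nat} (M : manifold R n) (Mb : manifold R n').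
Variables (iota : M -> Mb) (si : smooth_map iota).
Implicit Types (i : chart M) (a : chart Mb) (q : M).

Lemma chart_domain_open i a (U : set M) : open U ->
  open (coord i @` (dom i `&` iota @^-1` dom a `&` U)).
Proof.
move=> oU; rewrite -setIA; apply: chart_image_open; apply: openI => //.
have [ci _] := si; apply: open_comp; last exact: dom_open.
by move=> ? _; exact: ci.
Qed.

Lemma local_map_differentiable i a q : dom i q -> dom a (iota q) ->
  differentiable (coord a \o iota \o param i) (coord i q).
Proof.
move=> iq aq; have [_ /(_ i a) s] := si.
by apply: (smooth_on_differentiable s); exists q.
Qed.

(** Chain rule along the two ways from the preferred chart at [q] to [a]: through the preferred
    chart at [iota q], or through [i]. *)
Lemma tangent_map_chart i a q : dom i q -> dom a (iota q) ->
  tangent_map iota q *m chart_comp a (iota q) =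
  chart_comp i q *m jacobian (coord a \o iota \o param i) (coord i q).
Proof.
move=> iq aq; rewrite /tangent_map /chart_comp.
set c := chart_at q; set b := chart_at (iota q).
have cq : dom c q := mem_chart_at q.
have bq : dom b (iota q) := mem_chart_at (iota q).
have d1 := local_map_differentiable cq bq.
have d2 := transition_differentiable bq aq.
have d3 := transition_differentiable cq iq.
have d4 := local_map_differentiable iq aq.
have e1 : coord b (iota q) = (coord b \o iota \o param c) (coord c q).
  by rewrite /= coordK.
have e2 : coord i q = (coord i \o param c) (coord c q) by rewrite /= coordK.
rewrite e1 in d2 *; rewrite e2 in d4 *.
rewrite -(jacobian_comp d1 d2) -(jacobian_comp d3 d4).
have op W W' : open (W : set M) -> open (W' : set Mb) ->
    open (coord c @` (dom c `&` (W `&` iota @^-1` W'))).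
  move=> oW oW'; apply: chart_image_open; apply: openI => //.
  by have [ci _] := si; apply: open_comp => // ? _; exact: ci.
apply: (@open_eq_jacobian _ _ _
  (coord c @` (dom c `&` (dom i `&` iota @^-1` (dom a `&` dom b))))).
- by apply: op; [exact: dom_open|apply: openI; exact: dom_open].
- by exists q.
- move=> y [z [cz [iz [az bz]]] <-] /=.
  by rewrite (coordK cz) (coordK iz) (coordK bz).
- exact: (differentiable_comp d1 d2).
Qed.

Lemma comp_along_push X i a q : dom i q -> dom a (iota q) ->
  comp_along iota (push iota X) a q =
  comp_along (fun p => p) X i q *m jacobian (coord a \o iota \o param i) (coord i q).
Proof.
by move=> iq aq; rewrite /comp_along /push -!mulmxA (tangent_map_chart iq aq).
Qed.

Lemma comp_along_push_field X i a q : dom i q -> dom a (iota q) ->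
  comp_along iota (push iota X) a q =
  push_field (coord a \o iota \o param i) (comp_along (fun p => p) X i \o param i)
    (coord i q).
Proof.
move=> iq aq; rewrite (comp_along_push X iq aq) /push_field /= (coordK iq).
by rewrite deriveEjacobian//; exact: local_map_differentiable.
Qed.

Lemma smooth_field_local U X i a : smooth_field U X ->
  smooth_on (coord i @` (dom i `&` iota @^-1` dom a `&` U))
    (comp_along (fun p => p) X i \o param i).
Proof.
move=> /(_ i i); apply: smooth_on_sub => _ [q [[iq aq] Uq] <-].
by exists q.
Qed.

Lemma smooth_push U X : open U -> smooth_field U X -> smooth_along iota U (push iota X).
Proof.
move=> oU sX i a; have oD := @chart_domain_open i a U oU.
have [_ /(_ i a) sf] := si.
have sD : coord i @` (dom i `&` iota @^-1` dom a `&` U) `<=`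
    coord i @` (dom i `&` iota @^-1` dom a).
  by move=> _ [q [[iq aq] Uq] <-]; exists q.
have := push_field_smooth oD (smooth_on_sub sD sf) (@smooth_field_local U X i a sX).
apply: smooth_on_eq => // _ [q [[iq aq] Uq] <-].
rewrite [RHS]/= (coordK iq); exact: esym (comp_along_push_field X iq aq).
Qed.

End Push_forward.

(** * Metric and curvature of the ambient manifold in a chart *)

Section Metric_in_charts.
Context {R : realType} {n : nat} (M : manifold R n) (G : M -> 'M[R]_n).
Implicit Types (a : chart M) (q : M).

Definition local_metric a : 'rV[R]_n -> 'M[R]_n := chart_metric G a \o param a.

Lemma local_metricE a q : dom a q -> local_metric a (coord a q) = chart_metric G a q.
Proof. by move=> aq; rewrite /local_metric /= (coordK aq). Qed.

Lemma gbar_chart a q v w : dom a q -> gbar G q v w =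
  inner (local_metric a (coord a q)) (v *m chart_comp a q) (w *m chart_comp a q).
Proof.
move=> aq; have CF := chart_comp_frame aq.
rewrite local_metricE// /inner /chart_metric.
transitivity ((v *m (chart_comp a q *m chart_frame a q) *m G q
  *m (w *m (chart_comp a q *m chart_frame a q))^T) 0 0).
  by rewrite CF !mulmx1.
move: (chart_comp a q) (chart_frame a q) {CF} => C D.
by rewrite !trmx_mul !mulmxA.
Qed.

Lemma local_metric_sym a y : (forall q, (G q)^T = G q) ->
  (local_metric a y)^T = local_metric a y.
Proof.
move=> sG; rewrite /local_metric /= /chart_metric.
by move: (chart_frame a _) => C; rewrite !trmx_mul trmxK sG mulmxA.
Qed.

Lemma local_metric_unit a y : (forall q, G q \in unitmx) ->
  (coord a @` dom a) y -> local_metric a y \in unitmx.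
Proof.
move=> uG [q aq <-]; have [uC _] := mulmx1_unit (chart_frame_comp aq).
by rewrite local_metricE// /chart_metric !unitmx_mul unitmx_tr uG uC.
Qed.

Lemma christoffel_gamma a c b d q : dom a q ->
  christoffel G a c b d q = gamma (local_metric a) c b d (coord a q).
Proof. by move=> aq; rewrite /gamma local_metricE. Qed.

Lemma riemann_comp_curv a d c i j q : dom a q ->
  riemann_comp G a d c i j q = curv_comp (local_metric a) d c i j (coord a q).
Proof.
move=> aq.
have D u e b' c' : 'D_u (christoffel G a e b' c' \o param a) (coord a q) =
    'D_u (gamma (local_metric a) e b' c') (coord a q).
  apply: (@open_eq_derive _ _ _ (coord a @` dom a)).
  - exact: image_open.
  - by exists q.
  - by move=> _ [z az <-]; rewrite /= (coordK az) christoffel_gamma.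
rewrite /riemann_comp /curv_comp /coord_derive.
apply: congr2; first exact: (congr2 (fun s t => s - t) (D _ _ _ _) (D _ _ _ _)).
by apply: eq_bigr => e _; rewrite !christoffel_gamma.
Qed.

(** Every coordinate vector [p] is the component vector of the tangent vector
    [p *m chart_frame a z], to which the curvature hypothesis applies. *)
Lemma curv_constant a k (y p q w : 'rV[R]_n) : constant_curvature G k ->
  (coord a @` dom a) y ->
  curv (local_metric a) y p q w =
  k *: (inner (local_metric a y) q w *: p - inner (local_metric a y) p w *: q).
Proof.
move=> ck [z az <-].
have JK v : v *m chart_frame a z *m chart_comp a z = v.
  by rewrite -mulmxA (chart_frame_comp az) mulmx1.
have := ck a z (p *m chart_frame a z) (q *m chart_frame a z) (w *m chart_frame a z) az.
rewrite !(gbar_chart _ _ az) /riemann; move: JK.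
move: (chart_comp a z) (chart_frame a z) => C D JK.
rewrite -scalemxAl mulmxBl -!scalemxAl !JK => <-.
rewrite /curv; apply: eq_mx => _ d.
by do 3 (apply: eq_bigr => ? _); rewrite riemann_comp_curv.
Qed.

End Metric_in_charts.

(** * The ambient connection in charts *)

Section Connection_in_charts.
Context {R : realType} {m n : nat} (M : manifold R m) (Mb : manifold R n).
Variables (G : Mb -> 'M[R]_n) (iota : M -> Mb) (U : set M)
  (nb : (M -> 'rV[R]_m) -> (M -> 'rV[R]_n) -> (M -> 'rV[R]_n)).
Hypotheses (si : smooth_map iota) (oU : open U) (Hnb : levi_civita_along G iota U nb).

(** The components that specify [nb X V] are those of [nab] for the map [iota] read in the charts
    [i] and [a]; all identities proved for [nab] thereby become available. *)
Lemma levi_civita_chart X V i a q :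
  smooth_field U X -> smooth_along iota U V -> dom i q -> dom a (iota q) -> U q ->
  comp_along iota (nb X V) a q =
  nab (coord a \o iota \o param i) (local_metric G a)
    ((comp_along (fun p => p) X i \o param i) (coord i q))
    (comp_along iota V a \o param i) (coord i q).
Proof.
move=> sX sV iq aq Uq; apply: etrans (Hnb sX sV Uq aq) _.
have dV : differentiable (comp_along iota V a \o param i) (coord i q).
  by apply: smooth_on_differentiable (sV i a) _; exists q.
have e1 := tderive_chart (X q) iq dV.
have eX : X q *m chart_comp i q = (comp_along (fun p => p) X i \o param i) (coord i q).
  by rewrite /= (coordK iq).
rewrite eX in e1; rewrite /nab; apply: congr2; first exact: e1.
have eP := comp_along_push_field si X iq aq.
have fq : (coord a \o iota \o param i) (coord i q) = coord a (iota q).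
  by rewrite /= (coordK iq).
have Vq : (comp_along iota V a \o param i) (coord i q) = comp_along iota V a q.
  by rewrite /= (coordK iq).
have eC := congr2 (christoffel_mx (local_metric G a)) (esym eP) fq.
apply: esym; apply: etrans (congr2 mulmx Vq eC) _; apply: esym.
move: (comp_along iota V a q) (comp_along iota (push iota X) a q) => v P.
apply/rowP => c; rewrite mxE [RHS]mxE exchange_big; apply: eq_bigr => d _ /=.
rewrite mxE big_distrr; apply: eq_bigr => b _ /=.
rewrite (christoffel_gamma G c b d aq).
by move: (gamma _ _ _ _ _) => r; ring.
Qed.

End Connection_in_charts.

Section Orthogonality.
Context {R : realType} {n : nat} {M : manifold R n} (G : M -> 'M[R]_n).

Lemma perp_gbar r x (W : 'M[R]_(r, n)) v w :
  (v <= perp G x W)%MS -> (w <= W)%MS -> gbar G x v w = 0.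
Proof.
move=> /sub_kermxP vW /submxP[D ->].
by rewrite /gbar trmx_mul -!mulmxA [G x *m _]mulmxA [v *m _]mulmxA vW mul0mx mxE.
Qed.

End Orthogonality.

(** * Half-lightlike submanifolds *)

Section Half_lightlike_Cartan.
Context {R : realType} {m : nat} {M : manifold R m.+1} {Mb : manifold R m.+3}.
Variables (G : Mb -> 'M[R]_m.+3) (iota : M -> Mb) (k : R)
  (S : M -> 'M[R]_m.+1) (K : M -> 'M[R]_m.+3) (U : set M)
  (E : nat -> M -> 'rV[R]_m.+1) (N L : M -> 'rV[R]_m.+3)
  (nb : (M -> 'rV[R]_m.+1) -> (M -> 'rV[R]_m.+3) -> (M -> 'rV[R]_m.+3))
  (I : induced_objects (M := M)) (lambda : nat -> M -> R).
Hypotheses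
  (GT : forall x, (G x)^T = G x) (GU : forall x, G x \in unitmx)
  (Gs : forall a : chart Mb, smooth_on (coord a @` dom a) (chart_metric G a \o param a))
  (Hk : constant_curvature G k) (si : smooth_map iota) (HK : coscreen G iota K)
  (oU : open U) (HNL : adapted_fields G iota S K U (E 0%N) N L)
  (Hnb : levi_civita_along G iota U nb)
  (HI : gauss_weingarten G iota S U (E 0%N) N L nb I)
  (Hirr : irrotational iota U (E 0%N) nb)
  (HEsmooth : forall i, (1 <= i < m.+1)%N -> smooth_field U (E i))
  (HEbasis : forall p, U p -> (S p == \matrix_(i < m) E i.+1 p)%MS)
  (HEorth : forall i j p, (1 <= i < m.+1)%N -> (1 <= j < m.+1)%N -> U p ->
     gind G iota p (E i p) (E j p) = (i == j)%:R)
  (HE0 : forall p, U p -> shapeX I (E 0%N) p = 0)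
  (Hlsmooth : forall i, (1 <= i < m.+1)%N -> smooth_fun U (lambda i))
  (HE : forall i p, (1 <= i < m.+1)%N -> U p ->
     shapeX I (E i) p = lambda i p *: E i p)
  (Hlconst : forall i, (1 <= i < m.+1)%N -> constant_along_screen S U (lambda i))
  (Htau : forall X p, smooth_field U X -> U p -> tau I X p = 0).

Local Notation T q := (tangent_map iota q).
Local Notation gb q := (gbar G (iota q)).

Let gbC q v w : gb q v w = gb q w v.
Proof. exact: inner_sym. Qed.

Let gbDl q u v w : gb q (u + v) w = gb q u w + gb q v w.
Proof. exact: innerDl. Qed.

Let gbZl q c v w : gb q (c *: v) w = c * gb q v w.
Proof. exact: innerZl. Qed.

Let gbNl q v w : gb q (- v) w = - gb q v w.
Proof. exact: innerNl. Qed.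

Let sE0 : smooth_field U (E 0%N).
Proof. by have [[]] := HNL. Qed.

Let sEi (i : 'I_m) : smooth_field U (E i.+1).
Proof. by apply: HEsmooth; rewrite /= ltnS. Qed.

Let normal_xi q : U q -> (E 0%N q *m T q <= normal_space G iota q)%MS.
Proof.
move=> Uq; have [[_ /(_ q Uq) /sub_kermxP rE] _ _ _] := HNL.
by apply/sub_kermxP; rewrite -mulmxA.
Qed.

Let normal_L q : U q -> (L q <= normal_space G iota q)%MS.
Proof.
move=> Uq; have [_ _ [_ /(_ q Uq) LK _] _] := HNL.
have [_ /(_ q) [[/andP[KN _] _] _]] := HK.
by apply: submx_trans LK (submx_trans (addsmxSl _ _) KN).
Qed.

Let screen_E q (i : 'I_m) : U q -> (E i.+1 q <= S q)%MS.
Proof.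
move=> Uq; have /andP[_] := HEbasis Uq; apply: submx_trans.
by rewrite -[X in (X <= _)%MS](rowK (fun i : 'I_m => E i.+1 q)) row_sub.
Qed.

Let gb_tan_xi q v : U q -> gb q (v *m T q) (E 0%N q *m T q) = 0.
Proof.
by move=> Uq; rewrite gbC; apply: perp_gbar (normal_xi Uq) _; exact: submxMl.
Qed.

Let gb_tan_L q v : U q -> gb q (v *m T q) (L q) = 0.
Proof.
by move=> Uq; rewrite gbC; apply: perp_gbar (normal_L Uq) _; exact: submxMl.
Qed.

Let perp_N q : U q -> (N q <= perp G (iota q) (S q *m T q + K q)%MS)%MS.
Proof. by move=> Uq; have [_ _ _ [_ /(_ q Uq) []]] := HNL. Qed.

Let gb_eN q (i : 'I_m) : U q -> gb q (E i.+1 q *m T q) (N q) = 0.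
Proof.
move=> Uq; rewrite gbC; apply: perp_gbar (perp_N Uq) _.
apply: submx_trans (addsmxSl _ _); apply: submxMr; exact: screen_E.
Qed.

Let gb_NL q : U q -> gb q (N q) (L q) = 0.
Proof.
move=> Uq; apply: perp_gbar (perp_N Uq) _; apply: submx_trans (addsmxSr _ _).
by have [_ _ [_ /(_ q Uq)]] := HNL.
Qed.

Let gb_LL q : U q -> gb q (L q) (L q) = 1.
Proof. by move=> Uq; have [_ _ [_ _ /(_ q Uq)]] := HNL. Qed.

Let gb_NN q : U q -> gb q (N q) (N q) = 0.
Proof. by move=> Uq; have [_ _ _ [_ /(_ q Uq) []]] := HNL. Qed.

Let gb_xiN q : U q -> gb q (E 0%N q *m T q) (N q) = 1.
Proof. by move=> Uq; have [_ _ _ [_ /(_ q Uq) []]] := HNL. Qed.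

(** The left-hand side is tangent by irrotationality. Pairing the Gauss formula with [xi] and with
    [L], both orthogonal to the tangent space, shows that B(X, xi) and D(X, xi) vanish, and tau = 0
    leaves only the screen shape operator. *)
Let nb_xi X q : smooth_field U X -> U q ->
  nb X (push iota (E 0%N)) q = - (shapeX I X q *m T q).
Proof.
move=> sX Uq; have [_ _ /(_ q Uq) [eY _ _ _ exi]] := HI sX sE0.
have /submxP [D eD] := Hirr sX Uq.
have B0 : fundB I X (E 0%N) q = 0.
  have := congr1 (fun v => gb q v (E 0%N q *m T q)) eY.
  rewrite eD gb_tan_xi// !gbDl !gbZl.
  rewrite [X in _ = X + _ + _]gb_tan_xi// (gbC _ (N q)) gb_xiN// mulr1.
  by rewrite (gbC _ (L q)) gb_tan_L// mulr0 addr0 add0r => <-.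
have D0 : fundD I X (E 0%N) q = 0.
  have := congr1 (fun v => gb q v (L q)) eY.
  rewrite eD gb_tan_L// !gbDl !gbZl.
  rewrite [X in _ = X + _ + _]gb_tan_L// gb_NL// gb_LL// mulr1.
  by rewrite mulr0 addr0 add0r => <-.
rewrite eY B0 D0 !scale0r !addr0 /push exi Htau// scale0r subr0.
by rewrite mulNmx.
Qed.

Let nb_N X q (j : 'I_m) : smooth_field U X -> U q ->
  gb q (nb X N q) (E j.+1 q *m T q) = - gind G iota q (shapeN I X q) (E j.+1 q).
Proof.
move=> sX Uq; have [_ _ /(_ q Uq) [_ -> _ _ _]] := HI sX sE0.
rewrite !gbDl !gbZl gbNl.
rewrite [X in _ + _ * X + _]gbC [X in _ + _ * X]gbC.
by rewrite gb_eN// gb_tan_L// !mulr0 !addr0.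
Qed.

Let nb_L X q (j : 'I_m) : smooth_field U X -> U q ->
  gb q (nb X L q) (E j.+1 q *m T q) = - gind G iota q (shapeL I X q) (E j.+1 q).
Proof.
move=> sX Uq; have [_ _ /(_ q Uq) [_ _ -> _ _]] := HI sX sE0.
rewrite !gbDl !gbZl gbNl.
by rewrite [X in _ + _ * X]gbC gb_eN// mulr0 addr0.
Qed.

(** * Transfer to a pair of charts *)

Section In_chart.
Variables (i : chart M) (a : chart Mb).

Let O : set 'rV[R]_m.+1 := coord i @` (dom i `&` iota @^-1` dom a `&` U).
Let Q : set 'rV[R]_m.+3 := coord a @` dom a.
Let f := coord a \o iota \o param i.
Let tan (X : M -> 'rV[R]_m.+1) := comp_along (fun p => p) X i \o param i.
Let amb (V : M -> 'rV[R]_m.+3) := comp_along iota V a \o param i.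
Let gl := local_metric G a.

Let oO : open O.
Proof. exact: chart_domain_open. Qed.

Let oQ : open Q.
Proof. exact: image_open. Qed.

Let sf : smooth_on O f.
Proof.
have [_ /(_ i a)] := si; apply: smooth_on_sub => _ [q [[iq aq] Uq] <-].
by exists q.
Qed.

Let fE q : dom i q -> f (coord i q) = coord a (iota q).
Proof. by move=> iq; rewrite /f /= (coordK iq). Qed.

Let fOQ x : O x -> Q (f x).
Proof. by move=> [q [[iq aq] Uq] <-]; rewrite fE//; exists (iota q). Qed.

Let ambE V q : dom i q -> amb V (coord i q) = V q *m chart_comp a (iota q).
Proof. by move=> iq; rewrite /amb /= (coordK iq). Qed.

Let ip_amb V W q : dom i q -> dom a (iota q) ->
  inner (gl (f (coord i q))) (amb V (coord i q)) (amb W (coord i q)) =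
  gb q (V q) (W q).
Proof. by move=> iq aq; rewrite fE// !ambE// (gbar_chart G _ _ aq). Qed.

Let push_amb X q : dom i q -> dom a (iota q) ->
  push_field f (tan X) (coord i q) = amb (push iota X) (coord i q).
Proof.
move=> iq aq; rewrite -(comp_along_push_field si X iq aq).
by rewrite /amb /= (coordK iq).
Qed.

(** The coordinate vector [u] is realised by the tangent vector [u *m chart_frame i q] at [q]. The
    constant function with this value is used only at [q]; its smoothness as a field is not
    claimed. *)
Let derive_amb u q : dom i q -> dom a (iota q) ->
  'D_u f (coord i q) = amb (push iota (fun _ => u *m chart_frame i q)) (coord i q).
Proof.
move=> iq aq; apply: etrans (push_amb _ iq aq).
have e : tan (fun _ => u *m chart_frame i q) (coord i q) = u.
  by rewrite /tan /= (coordK iq) /comp_along -mulmxA (chart_frame_comp iq) mulmx1.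
exact: (congr1 (fun w => 'D_w f (coord i q)) (esym e)).
Qed.

Let nab_amb X V q : smooth_field U X -> smooth_along iota U V ->
  dom i q -> dom a (iota q) -> U q ->
  nab f gl (tan X (coord i q)) (amb V) (coord i q) = amb (nb X V) (coord i q).
Proof.
move=> sX sV iq aq Uq; apply: etrans (esym (levi_civita_chart si Hnb sX sV iq aq Uq)) _.
by rewrite /amb /= (coordK iq).
Qed.

Let nab_push X q : smooth_field U X -> dom i q -> dom a (iota q) -> U q ->
  nab f gl (tan X (coord i q)) (push_field f (tan (E 0%N))) (coord i q) =
  amb (fun q => - (shapeX I X q *m T q)) (coord i q).
Proof.
move=> sX iq aq Uq.
have Oq : O (coord i q) by exists q.
have e : forall y, O y -> push_field f (tan (E 0%N)) y = amb (push iota (E 0%N)) y.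
  by move=> _ [z [[iz az] Uz] <-]; exact: push_amb.
apply: etrans (nab_eq f gl oO _ Oq e) _.
apply: etrans (nab_amb sX (smooth_push si oU sE0) iq aq Uq) _.
by rewrite !ambE// nb_xi.
Qed.

Let tan_smooth X : smooth_field U X -> smooth_on O (tan X).
Proof. exact: smooth_field_local. Qed.

Let lam (l : 'I_m) := lambda l.+1 \o param i.

Let ltl (l : 'I_m) : (1 <= l.+1 < m.+1)%N.
Proof. by rewrite /= ltnS. Qed.

Let lam_smooth l : smooth_on O (lam l).
Proof.
have := @Hlsmooth l.+1 (ltl l) i; apply: smooth_on_sub => _ [q [[iq aq] Uq] <-].
by exists q.
Qed.

Let derive_lam (j l : 'I_m) q : dom i q -> dom a (iota q) -> U q ->
  'D_(tan (E j.+1) (coord i q)) (lam l) (coord i q) = 0.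
Proof.
move=> iq aq Uq; have Oq : O (coord i q) by exists q.
have dl : differentiable (lam l) (coord i q).
  exact: smooth_on_differentiable (lam_smooth l) Oq.
have e := tderive_chart (E j.+1 q) iq dl.
have -> : tan (E j.+1) (coord i q) = E j.+1 q *m chart_comp i q.
  by rewrite /tan /= (coordK iq).
apply: etrans (esym e) _; apply: (Hlconst (ltl l) (sEi j)) => // z Uz.
exact: screen_E.
Qed.

Lemma half_lightlike_cartan_chart q (j : 'I_m) : dom i q -> dom a (iota q) -> U q ->
  \sum_(l : 'I_m | lambda l.+1 q != lambda j.+1 q)
    (k + lambda l.+1 q * gind G iota q (shapeN I (E j.+1) q) (E j.+1 q)
       + lambda j.+1 q * gind G iota q (shapeN I (E l.+1) q) (E l.+1 q)
       + gind G iota q (shapeL I (E l.+1) q) (E l.+1 q)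
         * gind G iota q (shapeL I (E j.+1) q) (E j.+1 q)
       - gind G iota q (shapeL I (E j.+1) q) (E l.+1 q) ^+ 2)
    / (lambda j.+1 q - lambda l.+1 q) = 0.
Proof.
move=> iq aq Uq; have Oq : O (coord i q) by exists q.
have sN : smooth_along iota U N by have [_ _ _ []] := HNL.
have sL : smooth_along iota U L by have [_ _ []] := HNL.
have sNO : smooth_on O (amb N) by exact: sN.
have sLO : smooth_on O (amb L) by exact: sL.
have ip_ee (l l' : 'I_m) x : O x -> inner (gl (f x))
    (push_field f (tan (E l.+1)) x) (push_field f (tan (E l'.+1)) x) = (l == l')%:R.
  move=> [z [[iz az] Uz] <-]; rewrite !push_amb// ip_amb//.
  exact: (HEorth (ltl l) (ltl l') Uz).
have tan_xi u x : O x ->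
    inner (gl (f x)) ('D_u f x) (push_field f (tan (E 0%N)) x) = 0.
  move=> [z [[iz az] Uz] <-]; rewrite push_amb// derive_amb// ip_amb//.
  exact: gb_tan_xi.
have tan_L u x : O x -> inner (gl (f x)) ('D_u f x) (amb L x) = 0.
  by move=> [z [[iz az] Uz] <-]; rewrite derive_amb// ip_amb//; exact: gb_tan_L.
have eN (l : 'I_m) x : O x ->
    inner (gl (f x)) (push_field f (tan (E l.+1)) x) (amb N x) = 0.
  by move=> [z [[iz az] Uz] <-]; rewrite push_amb// ip_amb//; exact: gb_eN.
have xiN x : O x -> inner (gl (f x)) (push_field f (tan (E 0%N)) x) (amb N x) = 1.
  by move=> [z [[iz az] Uz] <-]; rewrite push_amb// ip_amb//; exact: gb_xiN.
have NN x : O x -> inner (gl (f x)) (amb N x) (amb N x) = 0.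
  by move=> [z [[iz az] Uz] <-]; rewrite ip_amb//; exact: gb_NN.
have NL x : O x -> inner (gl (f x)) (amb N x) (amb L x) = 0.
  by move=> [z [[iz az] Uz] <-]; rewrite ip_amb//; exact: gb_NL.
have LL x : O x -> inner (gl (f x)) (amb L x) (amb L x) = 1.
  by move=> [z [[iz az] Uz] <-]; rewrite ip_amb//; exact: gb_LL.
have lamE (l : 'I_m) z : dom i z -> lam l (coord i z) = lambda l.+1 z.
  by move=> iz; rewrite /lam /= (coordK iz).
have nab_e_xi (l : 'I_m) x : O x ->
    nab f gl (tan (E l.+1) x) (push_field f (tan (E 0%N))) x =
    - lam l x *: push_field f (tan (E l.+1)) x.
  move=> [z [[iz az] Uz] <-]; apply: etrans (nab_push (sEi l) iz az Uz) _.
  rewrite push_amb// !ambE// lamE// (HE (ltl l) Uz) /push.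
  by rewrite -scalemxAl mulNmx -scalemxAl scaleNr.
have nab_xi_xi x : O x -> nab f gl (tan (E 0%N) x) (push_field f (tan (E 0%N))) x = 0.
  move=> [z [[iz az] Uz] <-]; apply: etrans (nab_push sE0 iz az Uz) _.
  by rewrite ambE// HE0// mul0mx oppr0 mul0mx.
have e_lam (l l' : 'I_m) x : O x -> 'D_(tan (E l.+1) x) (lam l') x = 0.
  by move=> [z [[iz az] Uz] <-]; exact: derive_lam.
have flat := @flat_cartan R m O Q f gl k (tan (E 0%N)) (fun l => tan (E l.+1))
  (amb N) (amb L) lam oO oQ sf fOQ (@Gs a)
  (fun y _ => local_metric_sym a y GT) (fun y Qy => local_metric_unit GU Qy)
  (fun y p v w Qy => curv_constant p v w Hk Qy)
  (tan_smooth sE0) (fun l => tan_smooth (sEi l)) sNO sLO lam_smooth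
  ip_ee tan_xi tan_L eN xiN NN NL LL nab_e_xi nab_xi_xi e_lam (coord i q) j Oq.
have kN (l l' : 'I_m) : inner (gl (f (coord i q)))
    (nab f gl (tan (E l.+1) (coord i q)) (amb N) (coord i q))
    (push_field f (tan (E l'.+1)) (coord i q)) =
    - gind G iota q (shapeN I (E l.+1) q) (E l'.+1 q).
  by rewrite push_amb// nab_amb// ip_amb//; exact: nb_N.
have kL (l l' : 'I_m) : inner (gl (f (coord i q)))
    (nab f gl (tan (E l.+1) (coord i q)) (amb L) (coord i q))
    (push_field f (tan (E l'.+1)) (coord i q)) =
    - gind G iota q (shapeL I (E l.+1) q) (E l'.+1 q).
  by rewrite push_amb// nab_amb// ip_amb//; exact: nb_L.
apply: etrans flat; apply: eq_big => [l|l _]; first by rewrite !lamE.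
(* The tangential parts of the derivatives of [N] and [L] are the opposites of A_N and A_L. The A_N
   terms are linear and change sign, while the A_L terms are quadratic and do not. *)
have summand (x y x' y' b c d h n b' c' d' h' n' : R) : x' = x -> y' = y ->
    b' = - b -> c' = - c -> d' = - d -> h' = - h -> n' = - n ->
    (k + x * b + y * c + d * h - n ^+ 2) / (y - x) =
    (k - x' * b' - y' * c' + d' * h' - n' ^+ 2) / (y' - x').
  by move=> -> -> -> -> -> -> ->; rewrite !mulrN mulNr !opprK sqrrN.
exact: (summand _ _ _ _ _ _ _ _ _ _ _ _ _ _ (lamE l q iq) (lamE j q iq)
  (kN j j) (kN l l) (kL l l) (kL j j) (kL j l)).
Qed.

End In_chart.
End Half_lightlike_Cartan.

Theorem theorem3p1 (R : realType) (m : nat)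
  (M : manifold R m) (Mb : manifold R m.+2)
  (G : Mb -> 'M[R]_m.+2) (iota : M -> Mb) (k : R)
  (S : M -> 'M[R]_m) (K : M -> 'M[R]_m.+2) (U : set M)
  (E : nat -> M -> 'rV[R]_m) (N L : M -> 'rV[R]_m.+2)
  (nb : (M -> 'rV[R]_m) -> (M -> 'rV[R]_m.+2) -> (M -> 'rV[R]_m.+2))
  (I : induced_objects (M := M)) (lambda : nat -> M -> R)
  (HG : lorentzian G) (Hk : constant_curvature G k)
  (HM : half_lightlike G iota) (HS : screen G iota S)
  (HK : coscreen G iota K) (HU : open U)
  (HNL : adapted_fields G iota S K U (E 0%N) N L)
  (Hnb : levi_civita_along G iota U nb)
  (HI : gauss_weingarten G iota S U (E 0%N) N L nb I)
  (Hirr : irrotational iota U (E 0%N) nb)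
  (HEsmooth : forall i, (1 <= i < m)%N -> smooth_field U (E i))
  (HEbasis : forall p, U p -> (S p == \matrix_(i < m.-1) E i.+1 p)%MS)
  (HEorth : forall i j p, (1 <= i < m)%N -> (1 <= j < m)%N -> U p ->
     gind G iota p (E i p) (E j p) = (i == j)%:R)
  (HE0 : forall p, U p -> shapeX I (E 0%N) p = 0)
  (Hlsmooth : forall i, (1 <= i < m)%N -> smooth_fun U (lambda i))
  (HE : forall i p, (1 <= i < m)%N -> U p ->
     shapeX I (E i) p = lambda i p *: E i p)
  (Hlconst : forall i, (1 <= i < m)%N -> constant_along_screen S U (lambda i))
  (Htau : forall X p, smooth_field U X -> U p -> tau I X p = 0) :
  let g := gind G iota in
  let AN i p := shapeN I (E i) p in
  let AL i p := shapeL I (E i) p in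
  (forall i p, (1 <= i < m)%N -> U p ->
     \sum_(1 <= j < m | lambda j p != lambda i p)
       (k + lambda j p * g p (AN i p) (E i p)
          + lambda i p * g p (AN j p) (E j p)
          + g p (AL j p) (E j p) * g p (AL i p) (E i p)
          - g p (AL i p) (E j p) ^+ 2)
       / (lambda i p - lambda j p) = 0) /\
  (forall cf : M -> R, screen_conformal U I cf ->
   forall i p, (1 <= i < m)%N -> U p ->
     \sum_(1 <= j < m | lambda j p != lambda i p)
       (k + 2 * cf p * lambda i p * lambda j p
          + g p (AL j p) (E j p) * g p (AL i p) (E i p)
          - g p (AL i p) (E j p) ^+ 2)
       / (lambda i p - lambda j p) = 0).
Proof.
have [sG uG lG _] := HG; have [[si _ _] _] := HM.
suff main i p : (1 <= i < m)%N -> U p ->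
    \sum_(1 <= j < m | lambda j p != lambda i p)
       (k + lambda j p * gind G iota p (shapeN I (E i) p) (E i p)
          + lambda i p * gind G iota p (shapeN I (E j) p) (E j p)
          + gind G iota p (shapeL I (E j) p) (E j p)
            * gind G iota p (shapeL I (E i) p) (E i p)
          - gind G iota p (shapeL I (E i) p) (E j p) ^+ 2)
       / (lambda i p - lambda j p) = 0.
  move=> g AN AL; split=> [|cf [_ _ conf] i p im Up]; first exact: main.
  have gZ c v w : g p (c *: v) w = c * g p v w.
    by rewrite /g /gind -scalemxAl; exact: innerZl.
  (* In the screen conformal case the two A_N terms both become [cf p * lambda i p * lambda j p],
     whence the coefficient 2. *)
  have gN l : (1 <= l < m)%N -> g p (shapeN I (E l) p) (E l p) = cf p * lambda l p.
    move=> lm; rewrite conf//; last exact: HEsmooth.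
    by rewrite HE// !gZ /g HEorth// eqxx mulr1.
  rewrite -[RHS](main i p im Up) big_seq_cond [RHS]big_seq_cond.
  apply: eq_bigr => j /andP[]; rewrite mem_index_iota => jm _.
  by rewrite -/g !gN//; congr (_ / _); rewrite /AL; ring.
case: i => // i /= im Up.
(* The screen has rank m - 1, so its frame is reindexed by the ordinals below m', the ordinal j
   standing for the index j + 1; m is positive because the range 1 <= i < m is inhabited. *)
have [m' em] : exists m', m = m'.+1 by exists m.-1; rewrite prednK// (leq_trans _ im).
subst m; rewrite big_add1 /= big_mkord.
have imo : (i < m')%N by rewrite -ltnS.
exact: (half_lightlike_cartan_chart sG uG lG Hk si HK HU HNL Hnb HI Hirr HEsmooth
  HEbasis HEorth HE0 Hlsmooth HE Hlconst Htau (Ordinal imo)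
  (mem_chart_at p) (mem_chart_at (iota p)) Up).
Qed.
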